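(* Let $\pi,\tilde\pi,\beta$ be stochastic policies of a $\gamma$-discounted Markov decision process with $0\le\gamma<1$, and let $Q_w$ be an arbitrary real-valued function of state-action pairs (the critic). Define $$\tilde J^{\beta,\nu=0,CV}(\pi,\tilde\pi) = J(\tilde\pi)+\mathbb{E}_{\rho^{\tilde\pi},\pi}\big[A^{\tilde\pi}(s_t,a_t)-A_w^{\tilde\pi}(s_t,a_t)\big]+\mathbb{E}_{\rho^{\beta}}\big[\bar A_w^{\pi,\tilde\pi}(s_t)\big].$$ If $\epsilon=\max_s|\bar A_w^{\pi,\tilde\pi}(s)|$ and $\zeta=\max_s|\bar A^{\pi,\tilde\pi}(s)|$, then $$\left| J(\pi)-\tilde J^{\beta,\nu=0,CV}(\pi,\tilde\pi)\right|\le \frac{2\gamma}{(1-\gamma)^2}\left(\epsilon\sqrt{D_{KL}^{\max}(\tilde\pi,\beta)}+\zeta\sqrt{D_{KL}^{\max}(\pi,\tilde\pi)}\right).$$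
   Context: Setting: a Markov decision process with reward $r(s,a)$, transition kernel $p(s_{t+1}|s_t,a_t)$, a fixed initial state distribution $\rho_0$ (the same for all policies), and discount factor $\gamma\in[0,1)$. A (stochastic) policy $\pi$ assigns to each state $s$ a probability distribution $\pi(\cdot|s)$ over actions. All expectations, values and maxima appearing are assumed well defined and finite (a maximum is read as a supremum when not attained), except that KL divergences may be $+\infty$, with $0\cdot\infty=0$. $J(\pi)=\mathbb{E}_{s_0,a_0,\dots\sim\pi}[\sum_{t\ge0}\gamma^t r(s_t,a_t)]$. $Q^\pi(s,a)$ is the expected discounted return starting from $s$, taking action $a$, and following $\pi$ afterwards; $V^\pi(s)=\mathbb{E}_{a\sim\pi(\cdot|s)}[Q^\pi(s,a)]$; $A^\pi(s,a)=Q^\pi(s,a)-V^\pi(s)$. $\rho_t^\pi$ is the distribution of $s_t$ when $s_0\sim\rho_0$ and $\pi$ is followed, and $\rho^\pi=\sum_{t=0}^\infty\gamma^t\rho_t^\pi$ is the unnormalized discounted state visitation measure. $\mathbb{E}_{\rho^\pi}[f(s_t)]$ denotes the integral of $f$ against $\rho^\pi$, i.e. $\sum_t\gamma^t\mathbb{E}_{s\sim\rho_t^\pi}[f(s)]$; $\mathbb{E}_{\rho^{\pi'},\pi}[g(s_t,a_t)]=\mathbb{E}_{\rho^{\pi'}}\big[\mathbb{E}_{a\sim\pi(\cdot|s_t)}[g(s_t,a)]\big]$. $A_w^{\tilde\pi}(s,a)=Q_w(s,a)-\mathbb{E}_{a'\sim\tilde\pi(\cdot|s)}[Q_w(s,a')]$;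 $\bar A_w^{\pi,\tilde\pi}(s)=\mathbb{E}_{a\sim\pi(\cdot|s)}[A_w^{\tilde\pi}(s,a)]$; $\bar A^{\pi,\tilde\pi}(s)=\mathbb{E}_{a\sim\pi(\cdot|s)}[A^{\tilde\pi}(s,a)]$. $D_{KL}^{\max}(\pi_1,\pi_2)=\max_s D_{KL}(\pi_1(\cdot|s),\pi_2(\cdot|s))$, where $D_{KL}$ is the Kullback-Leibler divergence.
   Formalization: It is additionally assumed that V^{π̃} is integrable with respect to ρ^π (automatic for bounded rewards), without which the claim can fail; finiteness of J and Q is read as absolute integrability of the discounted rewards. *)

(* Defs.v *)
From HB Require Import structures.
From mathcomp Require Import all_boot all_order all_algebra.
From mathcomp Require Import all_classical all_reals all_analysis.

Set Implicit Arguments.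
Unset Strict Implicit.
Unset Printing Implicit Defensive.
Import Order.TTheory GRing.Theory Num.Theory.
Import numFieldNormedType.Exports.
Local Open Scope classical_set_scope.
Local Open Scope ring_scope.

Section kernel_probability.
Context d d' (X : measurableType d) (Y : measurableType d') (R : realType).
Variables (k : R.-pker X ~> Y) (x : X).

(* [k x], carrying the structure of a probability measure, which the library
   does not attach to the values of a probability kernel. *)
Definition pker_at : set Y -> \bar R := k x.

HB.instance Definition _ := Measure.on pker_at.
HB.instance Definition _ :=
  Measure_isProbability.Build _ _ _ pker_at (prob_kernel x).

End kernel_probability.

Section divergence.
Context d (Y : measurableType d) (R : realType).
Local Open Scope ereal_scope.
Local Open Scope charge_scope.

(* [lne 0 = -oo], but the density vanishes only on a [P]-null set. *)
Definition KL (P Q : probability Y R) : \bar R :=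
  if `[< P `<< Q >]
  then \int[P]_y lne ('d (charge_of_finite_measure P) '/d Q y)
  else +oo.

End divergence.

Definition KLmax (R : realType) d d' (S : measurableType d)
    (A : measurableType d') (pi1 pi2 : R.-pker S ~> A) : \bar R :=
  ereal_sup (range (fun s => KL (pker_at pi1 s) (pker_at pi2 s))).

Record mdp (R : realType) d d' (S : measurableType d) (A : measurableType d')
  := MDP {
  reward : {mfun (S * A)%type >-> R} ;
  trans : R.-pker (S * A)%type ~> S ;
  init : probability S R ;
  disc : {nonneg R} ;
  disc_lt1 : disc%:num < 1 }.

Section trajectories.
Context (R : realType) d d' (S : measurableType d) (A : measurableType d').
Local Open Scope ereal_scope.

(* The law of [(s, a)] when [s ~ mu] and [a ~ pi(.|s)], on the rectangle
   [D `*` E]. *)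
Definition rect_law (mu : {measure set S -> \bar R}) (pi : R.-pker S ~> A)
    (D : set S) (E : set A) : \bar R :=
  \int[mu]_(s in D) pi s E.

(* Conditionally on [(s_i, a_i)] for [i <= t], the pair [(s_t+1, a_t+1)] is
   distributed as [trans M (s_t, a_t)] followed by [pi]; this is tested on
   rectangles, which generate the product sigma-algebras. *)
Definition markov_step (M : mdp R S A) d0 (Omega : measurableType d0)
    (st : nat -> {mfun Omega >-> S}) (ac : nat -> {mfun Omega >-> A})
    (pi : R.-pker S ~> A) (P : probability Omega R) : Prop :=
  forall (t : nat) (F : nat -> set (S * A)) (D : set S) (E : set A),
    (forall i, measurable (F i)) -> measurable D -> measurable E ->
    let past := [set w | forall i, (i <= t)%N -> F i (st i w, ac i w)] in
    P (past `&` st t.+1 @^-1` D `&` ac t.+1 @^-1` E) =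
    \int[P]_(w in past) rect_law (trans M (st t w, ac t w)) pi D E.

(* The state and action processes with their laws under every policy:
   [Pinit pi] has initial state drawn from [init M], and [Pfrom pi s a] starts
   from the pair [(s, a)] and follows [pi] afterwards.  The conditions
   determine the law of [(s_t, a_t)_t] uniquely; on the space of sequences
   such laws exist by the Ionescu-Tulcea theorem. *)
Record trajectory_model (M : mdp R S A) := TrajectoryModel {
  tdisp : measure_display ;
  Omega : measurableType tdisp ;
  st : nat -> {mfun Omega >-> S} ;
  ac : nat -> {mfun Omega >-> A} ;
  Pinit : R.-pker S ~> A -> probability Omega R ;
  Pfrom : R.-pker S ~> A -> S -> A -> probability Omega R ;
  Pinit_start : forall pi D E, measurable D -> measurable E ->
    Pinit pi (st 0 @^-1` D `&` ac 0 @^-1` E) = rect_law (init M) pi D E ;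
  Pinit_step : forall pi, markov_step M st ac pi (Pinit pi) ;
  Pfrom_start : forall pi s a D E, measurable D -> measurable E ->
    Pfrom pi s a (st 0 @^-1` D `&` ac 0 @^-1` E) = \d_(s, a) (D `*` E) ;
  Pfrom_step : forall pi s a, markov_step M st ac pi (Pfrom pi s a) }.

End trajectories.

Section values.
Context (R : realType) d d' (S : measurableType d) (A : measurableType d').
Context (M : mdp R S A) (T : trajectory_model M).
Implicit Types (pi : R.-pker S ~> A) (P : probability (Omega T) R).

Local Notation gamma := (disc M)%:num.

Definition discounted_return (w : Omega T) : R :=
  limn (series (fun t : nat => gamma ^+ t * reward M (st T t w, ac T t w))).

(* Absolute integrability: then [discounted_return] converges [P]-almost surely
   and is [P]-integrable. *)
Definition return_finite P : Prop :=
  (\int[P]_w (\sum_(0 <= t <oo)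
     (gamma ^+ t * `|reward M (st T t w, ac T t w)|)%:E) < +oo)%E.

Definition J pi : R := \int[Pinit T pi]_w discounted_return w.

Definition Qval pi (s : S) (a : A) : R :=
  \int[Pfrom T pi s a]_w discounted_return w.

Definition Vval pi (s : S) : R := \int[pi s]_a Qval pi s a.

Definition Adv pi (s : S) (a : A) : R := Qval pi s a - Vval pi s.

Definition state_law pi (t : nat) : probability S R :=
  distribution (Pinit T pi) (st T t).

Definition visitation pi : {measure set S -> \bar R} :=
  mseries (fun t : nat => mscale (gamma ^+ t)%:nng (state_law pi t)) 0.

Definition Adv_bar pi tpi (s : S) : R := \int[pi s]_a Adv tpi s a.

End values.

Section critic.
Context (R : realType) d d' (S : measurableType d) (A : measurableType d').
Implicit Types (pi tpi : R.-pker S ~> A) (Qw : S * A -> R).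

Definition AdvW Qw tpi (s : S) (a : A) : R :=
  Qw (s, a) - \int[tpi s]_a' Qw (s, a').

Definition AdvW_bar Qw pi tpi (s : S) : R := \int[pi s]_a AdvW Qw tpi s a.

End critic.

Definition Jtilde (R : realType) d d' (S : measurableType d)
    (A : measurableType d') (M : mdp R S A) (T : trajectory_model M)
    (Qw : S * A -> R) (beta pi tpi : R.-pker S ~> A) : R :=
  J T tpi
  + \int[visitation T tpi]_s \int[pi s]_a (Adv T tpi s a - AdvW Qw tpi s a)
  + \int[visitation T beta]_s AdvW_bar Qw pi tpi s.

(* Main.v *)
(** Write [Abar] and [Abar_w] for the averaged advantages and [rho] for the
visitation measures.  The performance difference lemma,
[J pi - J tpi = int Abar d(rho^pi)], turns the error into
[(int Abar d(rho^pi) - int Abar d(rho^tpi))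
 + (int Abar_w d(rho^tpi) - int Abar_w d(rho^beta))].
If two policies differ by at most [delta] in total variation norm at every
state, the laws of their states at time [t] differ by at most [t * delta], so
each bracket is at most the sup norm of its integrand times
[delta * sum_t t gamma^t = delta * gamma / (1 - gamma)^2].  Finally
[delta <= 2 sqrt KLmax], a weak form of Pinsker's inequality.

The performance difference lemma telescopes
[int Abar d(rho_t) = E r_t + gamma * E V(s_t+1) - E V(s_t)], which rests on the
Bellman equation.  The latter holds in [[0, +oo]] for the positive and for the
negative part of the reward, without any integrability, and is then subtracted;
the same decomposition gives the joint measurability of [Q], which is not among
the hypotheses. *)
Require Import Defs.
From HB Require Import structures.
From mathcomp Require Import all_boot all_order all_algebra.
From mathcomp Require Import all_classical all_reals all_analysis.
From mathcomp Require Import measurable_realfun ring lra.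
Import Order.TTheory GRing.Theory Num.Theory.
Import numFieldNormedType.Exports.
Local Open Scope classical_set_scope.
Local Open Scope ring_scope.
Set Implicit Arguments.
Unset Strict Implicit.
Unset Printing Implicit Defensive.

(** * Relative entropy and total variation *)

(* With [s = sqrt t]: [ln t >= 2 (1 - 1 / s)], and [2 c g (s^2 - 1)] is at most
   [(s - 1)^2 + 2 c^2 (s^2 + 1)] by AM-GM. *)
Lemma ln_ge_tilt (R : realType) (c g t : R) : 0 < t -> 0 <= c -> `|g| <= 1 ->
  2 * c * g - 2 * c ^+ 2 + 1 - (1 + 2 * c * g + 2 * c ^+ 2) / t <= ln t.
Proof.
move=> t0 c0 g1; pose s := Num.sqrt t.
have s0 : 0 < s by rewrite sqrtr_gt0.
have -> : t = s ^+ 2 by rewrite sqr_sqrtr// ltW.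
have ls : 1 - s^-1 <= ln s.
  have := @le_ln1Dx R (s^-1 - 1).
  rewrite (_ : 1 + (s^-1 - 1) = s^-1) ?lnV ?posrE//; last by ring.
  have : 0 < s^-1 by rewrite invr_gt0.
  move=> ? /(_ ltac:(lra)); lra.
rewrite lnXn// mulr2n; apply: le_trans (_ : (1 - s^-1) *+ 2 <= _); last lra.
have hg : g * (s ^+ 2 - 1) <= `|s - 1| * (s + 1).
  rewrite (le_trans (ler_norm _))// normrM.
  have -> : s ^+ 2 - 1 = (s - 1) * (s + 1) by ring.
  rewrite normrM [`|s + 1|]gtr0_norm; last lra.
  rewrite -[leRHS]mul1r ler_wpM2r// mulr_ge0//; lra.
have h2 := sqr_ge0 (`|s - 1| - c * (s + 1)).
have h3 : `|s - 1| ^+ 2 = (s - 1) ^+ 2 by rewrite real_normK// num_real.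
have h4 := sqr_ge0 (s - 1).
rewrite -subr_ge0.
set x := (X in 0 <= X).
have -> : x = ((s - 1) ^+ 2 + 2 * c ^+ 2 * (s ^+ 2 + 1) -
    2 * c * (g * (s ^+ 2 - 1))) / s ^+ 2.
  by rewrite /x; field; lra.
rewrite divr_ge0 ?sqr_ge0//.
have := ler_wpM2l (_ : 0 <= 2 * c) hg; move=> /(_ ltac:(lra)).
nra.
Qed.

Section lne_integral.
Context d (Y : measurableType d) (R : realType).
Local Open Scope ereal_scope.

Lemma measurable_lne (f : Y -> \bar R) : measurable_fun setT f ->
  measurable_fun setT (fun y => lne (f y)).
Proof.
move=> mf.
(* Past the first test, [f y <= (fine (f y))%:E] detects finiteness, because [fine +oo] is [0]. *)
have -> : (fun y => lne (f y)) = fun y => if f y <= 0 then -oo else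
    if f y <= (fine (f y))%:E then (ln (fine (f y)))%:E else +oo.
  apply/funext => y; case: (f y) => [r| |]//=; last by rewrite leNye.
  by rewrite lee_fin; case: ifP => //; rewrite lexx.
have mff : measurable_fun setT (fun y => fine (f y)) by exact: measurableT_comp.
apply: measurable_fun_ifT => //.
  by apply: measurable_fun_lee => //; exact: measurable_cst.
apply: measurable_fun_ifT => //.
- by apply: measurable_fun_lee => //; exact/measurable_EFinP.
- by apply/measurable_EFinP; exact: measurableT_comp.
Qed.

(** Positive and negative parts are compared separately. This serves where the upper function need
    not be integrable, as with the logarithm of a density when the divergence is infinite. *)
Lemma le_integral_integrable (mu : {measure set Y -> \bar R}) (f g : Y -> \bar R) :
  measurable_fun setT f -> mu.-integrable setT g -> (forall y, g y <= f y) ->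
  \int[mu]_y g y <= \int[mu]_y f y.
Proof.
move=> mf ig gf; have mg := measurable_int _ ig.
rewrite integralE [leRHS]integralE leeB//; apply: ge0_le_integral => //.
- exact: measurable_funepos.
- exact: measurable_funepos.
- by move=> y _; apply: (@funepos_le _ _ setT); rewrite ?inE.
- exact: measurable_funeneg.
- exact: measurable_funeneg.
- by move=> y _; apply: (@funeneg_le _ _ setT); rewrite ?inE.
Qed.

End lne_integral.

Section integrable_EFin.
Context d (Y : measurableType d) (R : realType) (mu : {measure set Y -> \bar R}).
Implicit Types f g : Y -> R.

Lemma integrable_EFinD f g : mu.-integrable setT (EFin \o f) ->
  mu.-integrable setT (EFin \o g) ->
  mu.-integrable setT (EFin \o (fun y => f y + g y)).
Proof. exact: integrableD. Qed.

Lemma integrable_EFinB f g : mu.-integrable setT (EFin \o f) ->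
  mu.-integrable setT (EFin \o g) ->
  mu.-integrable setT (EFin \o (fun y => f y - g y)).
Proof. exact: integrableB. Qed.

Lemma integrable_EFinZl (r : R) f : mu.-integrable setT (EFin \o f) ->
  mu.-integrable setT (EFin \o (fun y => r * f y)).
Proof. exact: integrableZl. Qed.

End integrable_EFin.

Lemma bounded_integrable d (Y : measurableType d) (R : realType)
    (mu : {measure set Y -> \bar R}) (f : Y -> R) (M : R) :
  (mu setT < +oo)%E -> measurable_fun setT f -> (forall y, `|f y| <= M) ->
  mu.-integrable setT (EFin \o f).
Proof.
move=> muy mf fM; apply: measurable_bounded_integrable => //.
by exists M; split; rewrite ?num_real// => N MN y _; exact: le_trans (fM y) (ltW MN).
Qed.

Lemma prob_bounded_integrable d (Y : measurableType d) (R : realType)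
    (P : probability Y R) (f : Y -> R) (M : R) :
  measurable_fun setT f -> (forall y, `|f y| <= M) ->
  P.-integrable setT (EFin \o f).
Proof.
by apply: bounded_integrable; rewrite [X in (X < _)%E](probability_setT P) ltry.
Qed.

Lemma prob_Rintegral_cst d (Y : measurableType d) (R : realType)
    (P : probability Y R) (r : R) : \int[P]_y r = r.
Proof.
by rewrite Rintegral_cst// [X in fine X](probability_setT P)/= mulr1.
Qed.

Section KL_lower_bound.
Context d (Y : measurableType d) (R : realType) (P Q : probability Y R).
Local Open Scope ereal_scope.
Local Open Scope charge_scope.
Hypothesis PQ : P `<< Q.

(** This version of the density is finite and nonnegative everywhere; it agrees [Q]-almost
    everywhere with the derivative that occurs in [KL]. *)
Let f := Radon_Nikodym_SigmaFinite.f P Q.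

Let mf : measurable_fun setT f.
Proof. exact: measurable_int (Radon_Nikodym_SigmaFinite.f_integrable PQ). Qed.

Let mff : measurable_fun setT (fun y => fine (f y)).
Proof. exact: measurableT_comp. Qed.

Let fineKf y : (fine (f y))%:E = f y.
Proof. by rewrite fineK// Radon_Nikodym_SigmaFinite.f_fin_num. Qed.

Let ff0 y : (0 <= fine (f y))%R.
Proof. by rewrite fine_ge0// Radon_Nikodym_SigmaFinite.f_ge0. Qed.

(** The [P]-mass of the set where [f] vanishes is the integral of [f] over that set against [Q],
    which is zero. *)
Let f_neq0 : {ae P, forall y, (0 < fine (f y))%R}.
Proof.
have mZ : measurable [set y | f y <= 0].
  rewrite -[X in measurable X]setTI; apply: emeasurable_fun_infty_c => //.
exists [set y | f y <= 0]; split => //.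
  rewrite (Radon_Nikodym_SigmaFinite.f_integral PQ)// integral0_eq// => y /= fy0.
  by apply/eqP; rewrite eq_le fy0/= Radon_Nikodym_SigmaFinite.f_ge0.
by move=> y /= /negP; rewrite -leNgt -lee_fin fineKf.
Qed.

(** A variational lower bound of Donsker-Varadhan type: [ln_ge_tilt] at [t = f y] is integrated
    against [P]. The quotient [psi / f] then contributes at most the integral of [psi] against [Q],
    that is [1 + 2 c * int g dQ + 2 c^2], and the constants add up to [- 4 c^2]. *)
Lemma KL_ge_tilt (c : R) (g : Y -> R) : measurable_fun setT g ->
  (forall y, `|g y| <= 1)%R -> (0 <= c)%R ->
  (2 * c * (\int[P]_y g y - \int[Q]_y g y) - 4 * c ^+ 2)%:E <= KL P Q.
Proof.
move=> mg g1 c0.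
pose psi y := (1 + 2 * c * g y + 2 * c ^+ 2)%R.
(* [expR (- ln x)] is [x^-1] for [0 < x]. *)
pose h y := (psi y * expR (- ln (fine (f y))))%R.
pose m y := (2 * c * g y - 2 * c ^+ 2 + 1 - h y)%R.
have mpsi : measurable_fun setT psi.
  by apply: measurable_funD => //; apply: measurable_funD => //; exact: measurable_funM.
have mh : measurable_fun setT h.
  apply: measurable_funM => //; apply: measurableT_comp => //.
  by apply: measurableT_comp => //; exact: measurableT_comp.
have mcg : measurable_fun setT (fun y => 2 * c * g y - 2 * c ^+ 2 + 1)%R.
  by apply: measurable_funD => //; apply: measurable_funB => //; exact: measurable_funM.
have mm : measurable_fun setT m by exact: measurable_funB.
have gl' y : (- 1 <= g y)%R by have := g1 y; rewrite ler_norml => /andP[].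
(* From [g >= -1]: [psi >= 1 - 2 c + 2 c^2 = (1 - c)^2 + c^2]. *)
have psi0 y : (0 <= psi y)%R.
  by rewrite /psi; have := gl' y; have := sqr_ge0 (c - 1); nra.
have h0 y : (0 <= h y)%R by rewrite mulr_ge0// expR_ge0.
have ig (mu : probability Y R) : mu.-integrable setT (EFin \o g).
  exact: prob_bounded_integrable g1.
have ic (mu : probability Y R) (r : R) : mu.-integrable setT (EFin \o cst r).
  exact: finite_measure_integrable_cst.
have icg (mu : probability Y R) :
    mu.-integrable setT (EFin \o (fun y => 2 * c * g y))%R.
  exact: (integrable_EFinZl _ (ig mu)).
have i1cg : Q.-integrable setT (EFin \o (fun y => 1 + 2 * c * g y))%R.
  exact: (integrable_EFinD (ic Q 1%R) (icg Q)).
have ipsi : Q.-integrable setT (EFin \o psi).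
  exact: (integrable_EFinD i1cg (ic Q _)).
(* Change of variables with density [f]. Equality may fail because [f * h] vanishes where [f = 0],
   while [psi] need not. *)
have hpsi : \int[P]_y (h y)%:E <= \int[Q]_y (psi y)%:E.
  have eh0 y : 0 <= (h y)%:E by rewrite lee_fin.
  have meh : measurable_fun setT (EFin \o h) by exact/measurable_EFinP.
  rewrite -(Radon_Nikodym_SigmaFinite.change_of_variables PQ eh0 measurableT meh).
  apply: ge0_le_integral => //.
  - by move=> y _; rewrite mule_ge0 ?lee_fin// Radon_Nikodym_SigmaFinite.f_ge0.
  - by apply: emeasurable_funM => //; exact/measurable_EFinP.
  - exact/measurable_EFinP.
  move=> y _; rewrite -/f -fineKf -EFinM lee_fin /h -mulrA.
  rewrite -[leRHS]mulr1 ler_wpM2l//.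
  have := ff0 y; rewrite le_eqVlt => /predU1P[<-|fy0]; first by rewrite mulr0.
  by rewrite expRN lnK ?posrE// mulVf// gt_eqF.
have ih : P.-integrable setT (EFin \o h).
  apply/integrableP; split; first exact/measurable_EFinP.
  under eq_integral do rewrite gee0_abs ?lee_fin//.
  apply: (le_lt_trans hpsi); exact: (integrable_lty measurableT ipsi).
have icgc : P.-integrable setT (EFin \o (fun y => 2 * c * g y - 2 * c ^+ 2))%R.
  exact: (integrable_EFinB (icg P) (ic P _)).
have icc : P.-integrable setT (EFin \o (fun y => 2 * c * g y - 2 * c ^+ 2 + 1)%R).
  exact: (integrable_EFinD icgc (ic P _)).
have im : P.-integrable setT (EFin \o m) by exact: (integrable_EFinB icc ih).
rewrite /KL asboolT//.
pose t := 'd (charge_of_finite_measure P) '/d Q.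
have mt : measurable_fun setT t.
  apply: (@measurable_int _ _ _ Q); apply: Radon_Nikodym_integrable; exact: PQ.
(* The maximum makes the lower bound [m] hold everywhere, not only [P]-almost
   everywhere. *)
have -> : \int[P]_y lne (t y) = \int[P]_y maxe (lne (f y)) (m y)%:E.
  apply: ae_eq_integral => //.
  - exact: measurable_lne.
  - apply: measurable_maxe; first exact: measurable_lne.
    exact/measurable_EFinP.
  (* The two versions of the density agree [Q]-almost everywhere, hence also [P]-almost
     everywhere. *)
  have := null_dominates_ae_eq measurableT PQ
    (ae_eq_Radon_Nikodym_SigmaFinite PQ measurableT).
  apply: filterS2 f_neq0 => y fy0 ft _; rewrite -[t y]ft// -/f -fineKf.
  rewrite lne_EFin// max_l// lee_fin /m /h expRN lnK ?posrE//.
  exact: ln_ge_tilt.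
apply: (@le_trans _ _ (\int[P]_y (m y)%:E)); last first.
  apply: le_integral_integrable => //.
    by apply: measurable_maxe; [exact: measurable_lne|exact/measurable_EFinP].
  by move=> y; rewrite le_max lexx orbT.
rewrite -(fineK (integrable_fin_num measurableT im)) lee_fin.
have Em : (\int[P]_y m y =
    2 * c * \int[P]_y g y - 2 * c ^+ 2 + 1 - \int[P]_y h y)%R.
  rewrite (RintegralB measurableT icc ih) (RintegralD measurableT icgc (ic P _)).
  rewrite (RintegralB measurableT (icg P) (ic P _)).
  by rewrite (RintegralZl _ measurableT (ig P)) !prob_Rintegral_cst.
have Epsi : (\int[Q]_y psi y = 1 + 2 * c * \int[Q]_y g y + 2 * c ^+ 2)%R.
  rewrite (RintegralD measurableT i1cg (ic Q _)).
  rewrite (RintegralD measurableT (ic Q _) (icg Q)).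
  by rewrite (RintegralZl _ measurableT (ig Q)) !prob_Rintegral_cst.
have : (\int[P]_y h y <= \int[Q]_y psi y)%R.
  by rewrite fine_le// ?integrable_fin_num.
rewrite -/(Rintegral P setT m) Em Epsi; lra.
Qed.

End KL_lower_bound.

Section total_variation.
Context d (Y : measurableType d) (R : realType) (P Q : probability Y R).
Local Open Scope ereal_scope.
Local Open Scope charge_scope.

(** The tilted bound at [c = 0]. *)
Lemma KL_ge0 : 0 <= KL P Q.
Proof.
have [PQ|nPQ] := pselect (P `<< Q); last by rewrite /KL asboolF.
have := @KL_ge_tilt _ _ _ _ _ PQ 0%R (cst 0%R) _ _ (lexx _).
rewrite !mulr0 mul0r expr0n/= mulr0 subr0; apply => //.
by move=> y; rewrite normr0.
Qed.

(** After scaling by [e^-1], [KL_ge_tilt] gives [2 c D - 4 c^2 <= k] for all [c >= 0]. The left side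
    is largest at [c = D / 4], with value [D^2 / 4], so [D <= 2 sqrt k]. The sign [s] yields the
    same bound for [- D]. *)
Lemma Rintegral_diff_KL (k e : R) (g : Y -> R) : measurable_fun setT g ->
  (forall y, `|g y| <= e)%R -> (0 <= k)%R -> KL P Q <= k%:E ->
  (`|\int[P]_y g y - \int[Q]_y g y| <= 2 * e * Num.sqrt k)%R.
Proof.
move=> mg ge k0 KLk.
have PQ : P `<< Q.
  by apply: contrapT => nPQ; move: KLk; rewrite /KL asboolF.
have e0 : (0 <= e)%R by exact: le_trans (ge point).
move: e0; rewrite le_eqVlt => /predU1P[e0|e0].
  have g0 : g = cst 0%R.
    by apply/funext => y; apply/eqP; rewrite -normr_le0 (le_trans (ge y))// -e0.
  by rewrite g0 !prob_Rintegral_cst subrr normr0 -e0 mulr0 mul0r.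
have ig (mu : probability Y R) : mu.-integrable setT (EFin \o g).
  exact: prob_bounded_integrable ge.
pose D := (e^-1 * (\int[P]_y g y - \int[Q]_y g y))%R.
have bound (s : R) : (`|s| = 1 -> s * D <= 2 * Num.sqrt k)%R.
  move=> s1; have [D0|D0] := leP (s * D)%R 0%R.
    by rewrite (le_trans D0)// mulr_ge0// sqrtr_ge0.
  pose g' y := (s * e^-1 * g y)%R.
  have mg' : measurable_fun setT g' by exact: measurable_funM.
  have g'1 y : (`|g' y| <= 1)%R.
    by rewrite /g' !normrM s1 mul1r normfV (gtr0_norm e0) mulrC ler_pdivrMr// mul1r.
  have := KL_ge_tilt PQ mg' g'1 (_ : 0 <= s * D / 4)%R.
  move=> /(_ ltac:(lra)) /le_trans /(_ KLk); rewrite lee_fin.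
  rewrite (_ : \int[P]_y g' y - \int[Q]_y g' y = s * D)%R => [Dk|]; last first.
    by rewrite !(RintegralZl _ measurableT (ig _)) -mulrBr -mulrA.
  have sk0 : (0 <= 2 * Num.sqrt k)%R by rewrite mulr_ge0// sqrtr_ge0.
  rewrite -ler_sqr ?nnegrE ?(ltW D0)//.
  rewrite [leRHS]exprMn sqr_sqrtr//; lra.
have -> : (\int[P]_y g y - \int[Q]_y g y = e * D)%R.
  by rewrite /D mulrA divff ?mul1r// gt_eqF.
rewrite normrM (gtr0_norm e0) mulrAC mulrC ler_wpM2r ?(ltW e0)//.
have := bound 1%R; have := bound (-1)%R; rewrite normrN normr1.
by rewrite mul1r mulN1r ler_norml lerNl => /(_ erefl) -> /(_ erefl) ->.
Qed.

End total_variation.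

(** * Kernels and signed Fubini *)

Section bind.
Context d d' (X : measurableType d) (Y : measurableType d') (R : realType).
Variables (mu : probability X R) (k : R.-pker X ~> Y).
Local Open Scope ereal_scope.

(** Seeing [mu] as a constant kernel from [unit] makes [bind] a composition of kernels, so that
    [integral_kcomp] applies to it. *)
Let cst_mu : R.-pker unit ~> X :=
  kprobability (@measurable_cst _ _ unit _ setT (mu : pprobability X R)).

Definition bind : {measure set Y -> \bar R} := (cst_mu \; kernel.kernel_snd k) tt.

Lemma bindE U : bind U = \int[mu]_x k x U.
Proof. by []. Qed.

Lemma integral_bind (f : Y -> \bar R) : (forall y, 0 <= f y) ->
  measurable_fun [set: Y] f -> \int[bind]_y f y = \int[mu]_x \int[k x]_y f y.
Proof. by move=> f0 mf; rewrite /bind [LHS]integral_kcomp. Qed.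

End bind.

Section iterated_Rintegral.
Context d d' (X : measurableType d) (Y : measurableType d') (R : realType).
Variables (k : R.-pker X ~> Y).
Local Open Scope ereal_scope.

Lemma measurable_integral_pker (f : X * Y -> \bar R) : measurable_fun setT f ->
  (forall z, 0 <= f z) -> measurable_fun setT (fun x => \int[k x]_y f (x, y)).
Proof. by move=> mf f0; exact: measurable_fun_integral_finite_kernel. Qed.

Section signed.
Variables (f : X * Y -> R) (mf : measurable_fun setT f).

Let ef := EFin \o f.
Let mef : measurable_fun setT ef. Proof. exact/measurable_EFinP. Qed.
Let Fp x := \int[k x]_y ef^\+ (x, y).
Let Fn x := \int[k x]_y ef^\- (x, y).

Let mFp : measurable_fun setT Fp.
Proof. by apply: measurable_integral_pker => //; exact: measurable_funepos. Qed.

Let mFn : measurable_fun setT Fn.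
Proof. by apply: measurable_integral_pker => //; exact: measurable_funeneg. Qed.

Let RintE x : (\int[k x]_y f (x, y))%R = fine (Fp x - Fn x).
Proof.
rewrite /Rintegral; congr fine; rewrite integralE; congr (_ - _);
  by apply: eq_integral => y _; rewrite ?(funeposE, funenegE).
Qed.

(** This covers points where the section is not integrable: [fine] of a difference of measurable
    extended functions is measurable. *)
Lemma measurable_Rintegral_pker :
  measurable_fun setT (fun x => \int[k x]_y f (x, y))%R.
Proof.
under eq_fun do rewrite RintE.
by apply: measurableT_comp => //; exact: emeasurable_funB.
Qed.

Variable mu : {measure set X -> \bar R}.
Hypothesis foo : \int[mu]_x \int[k x]_y `|f (x, y)|%:E < +oo.

Let iF (g : X * Y -> \bar R) : measurable_fun setT g -> (forall z, 0 <= g z) ->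
  (forall z, g z <= `|f z|%:E) ->
  mu.-integrable setT (fun x => \int[k x]_y g (x, y)).
Proof.
move=> mg g0 gf; apply/integrableP; split; first exact: measurable_integral_pker.
apply: le_lt_trans foo; apply: ge0_le_integral => //.
- by apply: measurableT_comp => //; exact: measurable_integral_pker.
- by apply: (@measurable_integral_pker (fun z => `|f z|%:E)) => //;
    apply/measurable_EFinP; exact: measurableT_comp.
- move=> x _; rewrite gee0_abs ?integral_ge0//; apply: ge0_le_integral => //.
  + exact: (measurableT_comp mg).
  + apply/measurable_EFinP; apply: measurableT_comp => //.
    exact: (measurableT_comp mf).
Qed.

Let iFp : mu.-integrable setT Fp.
Proof.
apply: iF => // [|z]; first exact: measurable_funepos.
by rewrite funeposE /ef/= -EFin_max lee_fin ge_max normr_ge0 ler_norm.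
Qed.

Let iFn : mu.-integrable setT Fn.
Proof.
apply: iF => // [|z]; first exact: measurable_funeneg.
by rewrite funenegE /ef/= -EFin_max lee_fin ge_max normr_ge0 andbT -normrN ler_norm.
Qed.

(** The inner integral is dominated by [Fp + Fn]; where [Fp] or [Fn] is infinite, [fine] returns [0]
    and the bound is trivial. *)
Lemma integrable_Rintegral_pker :
  mu.-integrable setT (EFin \o (fun x => \int[k x]_y f (x, y))%R).
Proof.
apply: (le_integrable measurableT _ _ (integrableD measurableT iFp iFn)).
  by apply/measurable_EFinP; exact: measurable_Rintegral_pker.
move=> x _; rewrite /= RintE.
have Fp0 : 0 <= Fp x by exact: integral_ge0.
have Fn0 : 0 <= Fn x by exact: integral_ge0.
rewrite gee0_abs; last exact: adde_ge0.
case: (Fp x) Fp0 => [p| |]//; case: (Fn x) Fn0 => [n| |]//; rewrite /= ?normr0 ?leey//.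
by rewrite !lee_fin => n0 p0; rewrite (le_trans (ler_normB _ _))// !ger0_norm.
Qed.

Lemma Rintegral_pkerE : (\int[mu]_x \int[k x]_y f (x, y))%R =
  (fine (\int[mu]_x \int[k x]_y ef^\+ (x, y)) -
   fine (\int[mu]_x \int[k x]_y ef^\- (x, y)))%R.
Proof.
have fp := integrable_fin_num measurableT iFp.
have fn := integrable_fin_num measurableT iFn.
rewrite -fineB// -integralB//; congr fine; apply: ae_eq_integral => //.
- by apply/measurable_EFinP; exact: measurable_Rintegral_pker.
- exact: emeasurable_funB.
have := integrable_ae measurableT iFp; have := integrable_ae measurableT iFn.
apply: filterS2 => x /(_ Logic.I) fnx /(_ Logic.I) fpx _.
by rewrite /= RintE fineK// fin_numB fpx.
Qed.

End signed.
End iterated_Rintegral.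

Section graph_kernel.
Context d d' (X : measurableType d) (Y : measurableType d') (R : realType).
Variable k : R.-pker X ~> Y.
Local Open Scope ereal_scope.

Let kid : R.-pker (X * Y)%type ~> (X * Y)%type := kdirac (@measurable_id _ _ setT).

(** The law of [(x, y)] for [y] drawn from [k x]: first [k], then the Dirac mass at the pair. *)
Definition graph_kernel : X -> {measure set (X * Y) -> \bar R} := mkcomp k kid.

HB.instance Definition _ := Kernel.on graph_kernel.

Let graph_kernelT x : graph_kernel x setT = 1.
Proof.
rewrite /graph_kernel/= /kcomp.
under eq_integral do rewrite (@prob_kernel _ _ _ _ _ kid).
by rewrite integral_cst// mul1e prob_kernel.
Qed.

HB.instance Definition _ :=
  Kernel_isProbability.Build _ _ _ _ _ graph_kernel graph_kernelT.

Lemma integral_graph_kernel x (f : X * Y -> \bar R) : (forall z, 0 <= f z) ->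
  measurable_fun setT f -> \int[graph_kernel x]_z f z = \int[k x]_y f (x, y).
Proof.
move=> f0 mf; rewrite /graph_kernel [LHS]integral_kcomp//.
by apply: eq_integral => y _; rewrite /= integral_dirac// diracT mul1e.
Qed.

End graph_kernel.

Section law_of_rectangles.
Context d d' (X : measurableType d) (Y : measurableType d') (R : realType).
Variables (nu : probability (X * Y)%type R) (mu : probability X R).
Variable k : R.-pker X ~> Y.
Local Open Scope ereal_scope.

(** Rectangles are stable under intersection and generate the product sigma-algebra, so [nu]
    coincides with [mu] bound to the graph kernel of [k]. *)
Lemma integral_pair_law (f : X * Y -> \bar R) :
  (forall D E, measurable D -> measurable E ->
    nu (D `*` E) = \int[mu]_(x in D) k x E) ->
  (forall z, 0 <= f z) -> measurable_fun setT f ->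
  \int[nu]_z f z = \int[mu]_x \int[k x]_y f (x, y).
Proof.
move=> nuE f0 mf; pose G : R.-pker X ~> (X * Y)%type := graph_kernel k.
transitivity (\int[bind mu G]_z f z); last first.
  rewrite integral_bind//.
  by apply: eq_integral => x _; exact: integral_graph_kernel.
apply: eq_measure_integral => U mU _.
pose rect : set (set (X * Y)) :=
  [set C | exists2 D, measurable D & exists2 E, measurable E & C = D `*` E].
apply: (measure_unique rect (fun=> setT)) => //.
- rewrite measurable_prod_measurableType; congr (<<s _ >>).
  apply/seteqP; split=> [_ [D mD [E mE <-]]|_ [D mD [E mE ->]]].
    by exists D => //; exists E.
  by exists D => //; exists E.
- move=> _ _ [D1 mD1 [E1 mE1 ->]] [D2 mD2 [E2 mE2 ->]].
  exists (D1 `&` D2); first exact: measurableI.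
  by exists (E1 `&` E2); [exact: measurableI|rewrite setXI].
- by move=> _; exists setT => //; exists setT => //; rewrite setXTT.
- by rewrite bigcup_const//; exists point.
- move=> _ [D mD [E mE ->]]; rewrite [LHS](nuE _ _ mD mE) bindE integral_mkcond.
  apply: eq_integral => x _; rewrite patchE.
  have mDE : measurable (D `*` E) by exact: measurableX.
  transitivity (\int[G x]_z (\1_(D `*` E) z)%:E); last first.
    by rewrite integral_indic// setIT.
  rewrite integral_graph_kernel//; last exact/measurable_EFinP.
  case: ifPn => xD.
    transitivity (\int[k x]_y (\1_E y)%:E); first by rewrite integral_indic// setIT.
    by apply: eq_integral => y _; rewrite !indicE in_setX/= xD.
  by rewrite integral0_eq// => y _; rewrite indicE in_setX/= (negbTE xD).
- by move=> _; rewrite [X in X < _](probability_setT nu) ltry.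
Qed.

End law_of_rectangles.

(** * Laws of the Markov chain *)

Section markov_laws.
Context (R : realType) d d' (S : measurableType d) (A : measurableType d').
Variables (M : mdp R S A) (d0 : measure_display) (Omega : measurableType d0).
Variables (st : nat -> {mfun Omega >-> S}) (ac : nat -> {mfun Omega >-> A}).
Variables (pi : R.-pker S ~> A) (P : probability Omega R).
Local Open Scope ereal_scope.

Definition st_ac t (w : Omega) : (S * A)%type := (st t w, ac t w).

Lemma measurable_st_ac t : measurable_fun setT (st_ac t).
Proof. exact/measurable_fun_pair. Qed.

HB.instance Definition _ t := isMeasurableFun.Build _ _ _ _ _ (measurable_st_ac t).

Definition pair_law t : probability (S * A)%type R :=
  distribution P (st_ac t : {mfun Omega >-> (S * A)%type}).

Lemma integral_pair_lawE t (f : (S * A)%type -> \bar R) : (forall z, 0 <= f z) ->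
  measurable_fun setT f ->
  \int[pair_law t]_z f z = \int[P]_w f (st t w, ac t w).
Proof. by move=> f0 mf; rewrite ge0_integral_distribution. Qed.

Hypothesis step : markov_step M st ac pi P.

(** This is [markov_step] with the past and the set of actions taken to be everything. *)
Lemma integral_next_state t (f : S -> \bar R) : (forall s, 0 <= f s) ->
  measurable_fun setT f ->
  \int[distribution P (st t.+1)]_s f s =
  \int[pair_law t]_z \int[trans M z]_s f s.
Proof.
move=> f0 mf.
rewrite -(integral_bind (pair_law t) (trans M))//.
apply: eq_measure_integral => U mU _; rewrite bindE integral_pair_lawE//; last first.
  exact: measurable_kernel.
have := step t (F := fun=> setT) (fun=> measurableT) mU measurableT.
rewrite /= (_ : [set w | _] = setT)//; last by apply/seteqP; split.
rewrite setTI preimage_setT setIT => E; rewrite [LHS]E.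
apply: eq_integral => w _; rewrite /rect_law.
under eq_integral do rewrite prob_kernel.
by rewrite integral_cst// mul1e.
Qed.

(** By [integral_pair_law] it is enough to know rectangles, which [markov_step] gives with a trivial
    past; the remaining state integral is then an instance of [integral_next_state]. *)
Lemma integral_next_pair t (f : (S * A)%type -> \bar R) : (forall z, 0 <= f z) ->
  measurable_fun setT f ->
  \int[pair_law t.+1]_z f z =
  \int[distribution P (st t.+1)]_s \int[pi s]_a f (s, a).
Proof.
move=> f0 mf; apply: integral_pair_law => // D E mD mE.
have := step t (F := fun=> setT) (fun=> measurableT) mD mE.
rewrite /= (_ : [set w | _] = setT)//; last by apply/seteqP; split.
rewrite setTI => PE; rewrite [LHS]PE [RHS]integral_mkcond.
have mpi : measurable_fun setT ((pi ^~ E) \_ D).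
  apply/(measurable_restrictT _ mD)/measurable_funTS.
  exact: (measurable_kernel pi E mE).
rewrite integral_next_state//; last first.
  by move=> s; rewrite patchE; case: ifP.
rewrite integral_pair_lawE; last 2 first.
- by move=> z; apply: integral_ge0 => s _; rewrite patchE; case: ifP.
- apply: measurable_fun_integral_kernel => //; first exact: measurable_kernel.
  by move=> s; rewrite patchE; case: ifP.
by apply: eq_integral => w _; rewrite /rect_law integral_mkcond.
Qed.

Lemma integral_state_action :
  (forall D E, measurable D -> measurable E ->
    P (st 0 @^-1` D `&` ac 0 @^-1` E) =
    rect_law (distribution P (st 0)) pi D E) ->
  forall t (f : (S * A)%type -> \bar R), (forall z, 0 <= f z) ->
  measurable_fun setT f ->
  \int[pair_law t]_z f z =
  \int[distribution P (st t)]_s \int[pi s]_a f (s, a).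
Proof.
move=> start [|t] f f0 mf; last exact: integral_next_pair.
by apply: integral_pair_law => // D E mD mE; exact: start.
Qed.

End markov_laws.

(** * Discounted series and signed disintegration *)

Lemma nneseries_cvg (R : realType) (u : nat -> R) (l : R) :
  (forall n, 0 <= u n) -> (\sum_(0 <= n <oo) (u n)%:E = l%:E)%E ->
  series u @ \oo --> l.
Proof.
move=> u0 ul; have := @is_cvg_nneseries _ (EFin \o u) xpredT 0%N.
move=> /(_ _)/cvg_ex[|l']; first by move=> n _; rewrite lee_fin.
move=> ul'; have ll' : l' = l%:E by rewrite -ul; apply/esym/cvg_lim.
move: ul'; rewrite ll' => /fine_cvgP[_].
apply: cvg_trans; apply: near_eq_cvg; apply: nearW => n /=.
by rewrite /series/= sumEFin.
Qed.

(** The two parts are summed in [[0, +oo]]. Finite sums have finite terms, so the partial sums may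
    be subtracted in [R]. *)
Lemma discounted_cvg d (Z : measurableType d) (R : realType)
    (m : nat -> {measure set Z -> \bar R}) (g : R) (f : Z -> R) (p n : R) :
  0 <= g ->
  (\sum_(0 <= t <oo) (g ^+ t)%:E * \int[m t]_z (EFin \o f)^\+ z = p%:E)%E ->
  (\sum_(0 <= t <oo) (g ^+ t)%:E * \int[m t]_z (EFin \o f)^\- z = n%:E)%E ->
  series (fun t => g ^+ t * \int[m t]_z f z) @ \oo --> p - n.
Proof.
move=> g0 pE nE.
pose P t := ((g ^+ t)%:E * \int[m t]_z (EFin \o f)^\+ z)%E.
pose N t := ((g ^+ t)%:E * \int[m t]_z (EFin \o f)^\- z)%E.
have gt0 t : (0 <= (g ^+ t)%:E)%E by rewrite lee_fin exprn_ge0.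
have P0 t : (0 <= P t)%E by rewrite mule_ge0// integral_ge0.
have N0 t : (0 <= N t)%E by rewrite mule_ge0// integral_ge0.
have fin_term (F : nat -> \bar R) (l : R) : (forall t, 0 <= F t)%E ->
    (\sum_(0 <= t <oo) F t = l%:E)%E -> forall t, F t \is a fin_num.
  move=> F0 Fl t; rewrite ge0_fin_numE//.
  apply: (@le_lt_trans _ _ l%:E); last exact: ltry.
  rewrite -Fl (@nneseriesD1 _ F t xpredT)// leeDl// nneseries_ge0//.
have Pfin := fin_term _ _ P0 pE; have Nfin := fin_term _ _ N0 nE.
have cp : series (fine \o P) @ \oo --> p.
  apply: nneseries_cvg; first by move=> t; rewrite fine_ge0.
  by rewrite -pE; apply: eq_eseriesr => t _; rewrite /= fineK.
have cn : series (fine \o N) @ \oo --> n.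
  apply: nneseries_cvg; first by move=> t; rewrite fine_ge0.
  by rewrite -nE; apply: eq_eseriesr => t _; rewrite /= fineK.
rewrite (_ : series _ = series (fine \o P) \- series (fine \o N)); first exact: cvgB.
apply/funext => k; rewrite /GRing.sub_fun/=.
rewrite /series/= -sumrB; apply: eq_bigr => t _ /=.
(* A zero weight, possible for [g = 0], leaves the integral at time [t] uncontrolled; only a nonzero
   weight transfers finiteness to it. *)
have [gt|gt] := eqVneq (g ^+ t) 0; first by rewrite /P /N gt !mul0e mul0r subr0.
have fin_of x : ((g ^+ t)%:E * x \is a fin_num)%E -> x \is a fin_num.
  move=> h; have -> : x = (((g ^+ t)^-1)%:E * ((g ^+ t)%:E * x))%E.
    by rewrite muleA -EFinM mulVf// mul1e.
  by rewrite fin_numM.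
have pf := fin_of _ (Pfin t); have nf := fin_of _ (Nfin t).
by rewrite !fineM// -mulrBr -fineB// -integralE.
Qed.

Section disintegration.
Context d d' d3 (X : measurableType d) (Y : measurableType d')
  (Z : measurableType d3) (R : realType).
Variables (k : R.-pker X ~> Y) (mu : {measure set X -> \bar R}).
Local Open Scope ereal_scope.

(* [u] and [v] need not be the positive and negative parts of [f]. *)
Lemma Rintegral_pker_diff (u v : X * Y -> \bar R) :
  measurable_fun setT u -> measurable_fun setT v ->
  (forall z, 0 <= u z) -> (forall z, 0 <= v z) ->
  (forall z, u z \is a fin_num) -> (forall z, v z \is a fin_num) ->
  \int[mu]_x \int[k x]_y u (x, y) < +oo ->
  \int[mu]_x \int[k x]_y v (x, y) < +oo ->
  let f z := (fine (u z) - fine (v z))%R in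
  mu.-integrable setT (EFin \o (fun x => \int[k x]_y f (x, y))%R) /\
  (\int[mu]_x \int[k x]_y f (x, y) =
   fine (\int[mu]_x \int[k x]_y u (x, y)) -
   fine (\int[mu]_x \int[k x]_y v (x, y)))%R.
Proof.
move=> mu_ mv u0 v0 ufin vfin uoo voo f.
have mf : measurable_fun setT f.
  by apply: measurable_funB; exact: measurableT_comp.
have mef : measurable_fun setT (EFin \o f) by exact/measurable_EFinP.
have ge0I (g : X * Y -> \bar R) : (forall z, 0 <= g z) ->
    0 <= \int[mu]_x \int[k x]_y g (x, y).
  by move=> g0; apply: integral_ge0 => x _; exact: integral_ge0.
have ID (g h : X * Y -> \bar R) : measurable_fun setT g -> measurable_fun setT h ->
    (forall z, 0 <= g z) -> (forall z, 0 <= h z) ->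
    \int[mu]_x \int[k x]_y (g (x, y) + h (x, y)) =
    \int[mu]_x \int[k x]_y g (x, y) + \int[mu]_x \int[k x]_y h (x, y).
  move=> mg mh g0 h0; rewrite -ge0_integralD//.
  - apply: eq_integral => x _; rewrite ge0_integralD//.
    + exact: (measurableT_comp mg).
    + exact: (measurableT_comp mh).
  - by move=> x _; exact: integral_ge0.
  - exact: measurable_integral_pker.
  - by move=> x _; exact: integral_ge0.
  - exact: measurable_integral_pker.
have Ile (g h : X * Y -> \bar R) : measurable_fun setT g -> measurable_fun setT h ->
    (forall z, 0 <= g z) -> (forall z, g z <= h z) ->
    \int[mu]_x \int[k x]_y g (x, y) <= \int[mu]_x \int[k x]_y h (x, y).
  move=> mg mh g0 gh; have h0 z : 0 <= h z by exact: le_trans (gh z).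
  apply: ge0_le_integral => //.
  - by move=> x _; exact: integral_ge0.
  - exact: measurable_integral_pker.
  - exact: measurable_integral_pker.
  move=> x _; apply: ge0_le_integral => //.
  - exact: (measurableT_comp mg).
  - exact: (measurableT_comp mh).
have mp : measurable_fun setT (EFin \o f)^\+ by exact: measurable_funepos.
have mn : measurable_fun setT (EFin \o f)^\- by exact: measurable_funeneg.
have fu z : (fine (u z))%:E = u z by rewrite fineK.
have fv z : (fine (v z))%:E = v z by rewrite fineK.
have fu0 z : (0 <= fine (u z))%R by rewrite fine_ge0.
have fv0 z : (0 <= fine (v z))%R by rewrite fine_ge0.
have foo : \int[mu]_x \int[k x]_y `|f (x, y)|%:E < +oo.
  apply: (@le_lt_trans _ _ (\int[mu]_x \int[k x]_y (u (x, y) + v (x, y)))); last first.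
    rewrite (ID _ _ mu_ mv u0 v0); exact: lte_add_pinfty.
  apply: (Ile (fun z => `|f z|%:E) (fun z => u z + v z)) => //.
  - by apply/measurable_EFinP; exact: measurableT_comp.
  - exact: emeasurable_funD.
  - move=> z; rewrite -fu -fv -EFinD lee_fin (le_trans (ler_normB _ _))//.
    by rewrite !ger0_norm.
split; first exact: integrable_Rintegral_pker.
rewrite (Rintegral_pkerE mf foo).
have lep z : (EFin \o f)^\+ z <= u z.
  rewrite funeposE -fu /= -EFin_max lee_fin ge_max fu0 andbT.
  by rewrite gerBl.
have len z : (EFin \o f)^\- z <= v z.
  rewrite funenegE -fv /= -EFin_max lee_fin ge_max fv0 andbT /f opprB.
  by rewrite gerBl.
have fin_numI (g : X * Y -> \bar R) : (forall z, 0 <= g z) ->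
    \int[mu]_x \int[k x]_y g (x, y) < +oo ->
    \int[mu]_x \int[k x]_y g (x, y) \is a fin_num.
  by move=> g0 goo; rewrite ge0_fin_numE// ge0I.
have pf : \int[mu]_x \int[k x]_y (EFin \o f)^\+ (x, y) \is a fin_num.
  apply: (fin_numI _ (@funepos_ge0 _ _ _)).
  exact: le_lt_trans (Ile _ _ mp mu_ (@funepos_ge0 _ _ _) lep) uoo.
have nf : \int[mu]_x \int[k x]_y (EFin \o f)^\- (x, y) \is a fin_num.
  apply: (fin_numI _ (@funeneg_ge0 _ _ _)).
  exact: le_lt_trans (Ile _ _ mn mv (@funeneg_ge0 _ _ _) len) voo.
have uf := fin_numI _ u0 uoo; have vf := fin_numI _ v0 voo.
(* Pointwise [f^+ + v = u + f^-]; both sides are integrated without subtraction, and since all four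
   integrals are finite the terms can then be moved across. *)
have balance : \int[mu]_x \int[k x]_y (EFin \o f)^\+ (x, y) +
    \int[mu]_x \int[k x]_y v (x, y) =
    \int[mu]_x \int[k x]_y u (x, y) +
    \int[mu]_x \int[k x]_y (EFin \o f)^\- (x, y).
  rewrite -(ID _ _ mp mv (@funepos_ge0 _ _ _) v0).
  rewrite -(ID _ _ mu_ mn u0 (@funeneg_ge0 _ _ _)).
  apply: eq_integral => x _; apply: eq_integral => y _.
  rewrite funeposE funenegE -fu -fv /= -!EFin_max -!EFinD; congr EFin.
  rewrite /f; move: (fine (u _)) (fine (v _)) => a b.
  by case: (leP 0%R (a - b)%R) => h; [rewrite max_r|rewrite max_l]; lra.
have := congr1 fine balance; rewrite (fineD pf vf) (fineD uf nf).
by have : (forall a b c e : R, a + b = c + e -> a - e = c - b)%R;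
  [move=> *; lra|apply].
Qed.

(** The formula for nonnegative functions is applied to [|f|], which gives integrability, and to the
    two parts of [f]. It is used with [phi = snd] for the next state and with [phi = id] for
    state-action pairs. *)
Lemma Rintegral_disintegration (nu : {measure set Z -> \bar R})
    (phi : X * Y -> Z) (f : Z -> R) : measurable_fun setT phi ->
  (forall g : Z -> \bar R, (forall z, 0 <= g z) -> measurable_fun setT g ->
    \int[nu]_z g z = \int[mu]_x \int[k x]_y g (phi (x, y))) ->
  nu.-integrable setT (EFin \o f) ->
  mu.-integrable setT (EFin \o (fun x => \int[k x]_y f (phi (x, y)))%R) /\
  (\int[nu]_z f z = \int[mu]_x \int[k x]_y f (phi (x, y)))%R.
Proof.
move=> mphi nuE intf.
have mef := measurable_int _ intf.
have mf : measurable_fun setT f by exact/measurable_EFinP.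
have mfphi : measurable_fun setT (f \o phi) by exact: measurableT_comp.
have foo : \int[mu]_x \int[k x]_y `|(f \o phi) (x, y)|%:E < +oo.
  have /integrableP[_] := intf; rewrite nuE//.
  exact: measurableT_comp.
split; first exact: (integrable_Rintegral_pker mfphi foo).
rewrite [RHS](Rintegral_pkerE mfphi foo).
rewrite [LHS]/Rintegral integralE fineB ?integrable_pos_fin_num ?integrable_neg_fin_num//.
rewrite !nuE; last 4 first.
- by [].
- exact: measurable_funeneg.
- by [].
- exact: measurable_funepos.
have pE : \int[mu]_x \int[k x]_y (EFin \o f)^\+ (phi (x, y)) =
    \int[mu]_x \int[k x]_y (EFin \o (f \o phi))^\+ (x, y).
  by apply: eq_integral => x _; apply: eq_integral => y _; rewrite !funeposE.
have nE : \int[mu]_x \int[k x]_y (EFin \o f)^\- (phi (x, y)) =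
    \int[mu]_x \int[k x]_y (EFin \o (f \o phi))^\- (x, y).
  by apply: eq_integral => x _; apply: eq_integral => y _; rewrite !funenegE.
by rewrite pE nE.
Qed.

End disintegration.

(** * Action values *)

Section step_operator.
Context (R : realType) d d' (S : measurableType d) (A : measurableType d').
Variables (M : mdp R S A) (pi : R.-pker S ~> A).
Local Open Scope ereal_scope.
Implicit Types (f q : (S * A)%type -> \bar R) (z : (S * A)%type).
Local Notation gamma := (disc M)%:num.

Definition step_op f z := \int[trans M z]_s \int[pi s]_a f (s, a).

Lemma step_op_ge0 f : (forall z, 0 <= f z) -> forall z, 0 <= step_op f z.
Proof. by move=> f0 z; apply: integral_ge0 => s _; exact: integral_ge0. Qed.

Lemma measurable_step_op f : measurable_fun setT f -> (forall z, 0 <= f z) ->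
  measurable_fun setT (step_op f).
Proof.
move=> mf f0; apply: measurable_fun_integral_kernel.
- exact: measurable_kernel.
- by move=> s; exact: integral_ge0.
- exact: measurable_integral_pker.
Qed.

Lemma step_opZ (c : R) f z : (0 <= c)%R -> measurable_fun setT f ->
  (forall z, 0 <= f z) -> step_op (fun z => c%:E * f z) z = c%:E * step_op f z.
Proof.
move=> c0 mf f0; rewrite /step_op -ge0_integralZl//.
- apply: eq_integral => s _; rewrite ge0_integralZl//.
  exact: (measurableT_comp mf).
- exact: measurable_integral_pker.
- by move=> s _; exact: integral_ge0.
Qed.

Lemma step_op_nneseries (f : nat -> (S * A)%type -> \bar R) z :
  (forall t, measurable_fun setT (f t)) -> (forall t z, 0 <= f t z) ->
  step_op (fun z => \sum_(0 <= t <oo) f t z) z =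
  \sum_(0 <= t <oo) step_op (f t) z.
Proof.
move=> mf f0; rewrite /step_op -integral_nneseries//.
- apply: eq_integral => s _; rewrite integral_nneseries// => t.
  exact: (measurableT_comp (mf t)).
- by move=> t; exact: measurable_integral_pker.
- by move=> t s _; exact: integral_ge0.
Qed.

Let iter_step q : measurable_fun setT q -> (forall z, 0 <= q z) -> forall t,
  measurable_fun setT (iter t step_op q) /\ (forall z, 0 <= iter t step_op q z).
Proof.
move=> mq q0; elim=> [//|t [mi i0]]; split; first exact: measurable_step_op.
exact: step_op_ge0.
Qed.

(* The action value of [pi] for a reward [q] with values in [[0, +oo]]. *)
Definition discounted_value q z :=
  \sum_(0 <= t <oo) (gamma ^+ t)%:E * iter t step_op q z.

Section nonneg.
Variable q : (S * A)%type -> \bar R.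
Hypotheses (mq : measurable_fun setT q) (q0 : forall z, 0 <= q z).

Let mi t : measurable_fun setT (iter t step_op q).
Proof. by have [] := iter_step mq q0 t. Qed.
Let i0 t z : 0 <= iter t step_op q z.
Proof. by have [_] := iter_step mq q0 t. Qed.
Let gi0 t z : 0 <= (gamma ^+ t)%:E * iter t step_op q z.
Proof. by rewrite mule_ge0// lee_fin exprn_ge0. Qed.
Let mgi t : measurable_fun setT (fun z => (gamma ^+ t)%:E * iter t step_op q z).
Proof. exact: measurable_funeM. Qed.

Lemma discounted_value_ge0 z : 0 <= discounted_value q z.
Proof. by apply: nneseries_ge0. Qed.

Lemma measurable_discounted_value : measurable_fun setT (discounted_value q).
Proof. by apply: ge0_emeasurable_sum. Qed.

(** The Bellman equation in [[0, +oo]]: the term [t = 0] is split off, and monotone convergence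
    takes [step_op] out of the shifted series. *)
Lemma discounted_value_rec z :
  discounted_value q z = q z + gamma%:E * step_op (discounted_value q) z.
Proof.
rewrite {1}/discounted_value nneseries_recl//= expr0 mul1e; congr (_ + _).
rewrite -(nneseries_addn 1)// step_op_nneseries// -nneseriesZl//; last first.
  by move=> t _; exact: step_op_ge0.
apply: eq_eseriesr => t _; rewrite addn1 step_opZ ?exprn_ge0//.
by rewrite muleA -EFinM -exprS.
Qed.

End nonneg.

Section chain.
Variables (d0 : measure_display) (Omega : measurableType d0).
Variables (st : nat -> {mfun Omega >-> S}) (ac : nat -> {mfun Omega >-> A}).
Variables (P : probability Omega R) (step : markov_step M st ac pi P).
Variable q : (S * A)%type -> \bar R.
Hypotheses (mq : measurable_fun setT q) (q0 : forall z, 0 <= q z).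

Let integral_step f t : measurable_fun setT f -> (forall z, 0 <= f z) ->
  \int[pair_law st ac P t.+1]_z f z = \int[pair_law st ac P t]_z step_op f z.
Proof.
move=> mf f0; rewrite (integral_next_pair step)// (integral_next_state step)//.
- by move=> s; exact: integral_ge0.
- exact: measurable_integral_pker.
Qed.

Let integral_iter t : \int[pair_law st ac P t]_z q z =
  \int[pair_law st ac P 0]_z iter t step_op q z.
Proof.
(* The induction ranges over all [q], because going back one step replaces the integrand by its
   image under [step_op]. *)
move: q mq q0; elim: t => [//|t ih] f mf f0.
rewrite integral_step// ih ?iterSr//; first exact: measurable_step_op.
exact: step_op_ge0.
Qed.

Lemma integral_discounted_sum :
  \int[P]_w \sum_(0 <= t <oo) ((gamma ^+ t)%:E * q (st t w, ac t w)) =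
  \sum_(0 <= t <oo) (gamma ^+ t)%:E * \int[pair_law st ac P t]_z q z.
Proof.
have mqt t : measurable_fun setT (fun w => q (st t w, ac t w)).
  exact: (measurableT_comp mq (measurable_st_ac st ac t)).
rewrite integral_nneseries//.
- apply: eq_eseriesr => t _; rewrite integral_pair_lawE// ge0_integralZl//.
- by move=> t; exact: measurable_funeM.
- by move=> t w _; rewrite mule_ge0// lee_fin exprn_ge0.
Qed.

(** The [t] steps of the chain are moved from the law onto the function; Tonelli then exchanges sum
    and integral. *)
Lemma integral_discounted_value :
  \sum_(0 <= t <oo) (gamma ^+ t)%:E * \int[pair_law st ac P t]_z q z =
  \int[pair_law st ac P 0]_z discounted_value q z.
Proof.
rewrite /discounted_value integral_nneseries//.
- apply: eq_eseriesr => t _; rewrite integral_iter ge0_integralZl//.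
  + by have [] := iter_step mq q0 t.
  + by move=> z _; have [_] := iter_step mq q0 t.
- by move=> t; apply: measurable_funeM; have [] := iter_step mq q0 t.
- move=> t z _; rewrite mule_ge0 ?lee_fin ?exprn_ge0//.
  by have [_] := iter_step mq q0 t.
Qed.

End chain.
End step_operator.

(* The case distinction is needed because [limn] is [point] where the sequence
   diverges. *)
Lemma measurable_limn d (T : measurableType d) (R : realType) (h : nat -> T -> R) :
  (forall n, measurable_fun setT (h n)) ->
  measurable_fun setT (fun x => limn (h ^~ x)).
Proof.
move=> mh.
pose eh n x := (h n x)%:E.
have meh n : measurable_fun setT (eh n) by exact/measurable_EFinP.
pose u x := limn_esup (eh ^~ x); pose l x := limn_einf (eh ^~ x).
have mu : measurable_fun setT u by exact: measurable_fun_limn_esup.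
have ml : measurable_fun setT l.
  apply: measurableT_comp => //.
  by apply: measurable_fun_limn_esup => n; exact: measurableT_comp.
(* Convergence in [R] amounts to equality and finiteness of the lower and upper limits, which is a
   measurable condition. *)
rewrite (_ : (fun x => _) = fun x =>
    if (l x == u x) && ((fine (u x))%:E == u x) then fine (u x) else point).
  apply: measurable_fun_ifT => //; last exact: measurableT_comp.
  apply: measurable_and; apply: measurable_fun_eqe => //.
  by apply/measurable_EFinP; exact: measurableT_comp.
apply/funext => x; case: ifPn => [/andP[/eqP lu /eqP fu]|lu].
  suff : eh ^~ x @ \oo --> (fine (u x))%:E.
    by move/fine_cvgP => [_ hx]; exact/cvg_lim.
  rewrite fu; apply: (@squeeze_cvge _ _ _ _ (einfs (eh ^~ x)) _ (esups (eh ^~ x))).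
  - apply: nearW => n; apply/andP; split.
      by apply: ereal_inf_lbound; exists n => /=.
    by apply: ereal_sup_ubound; exists n => /=.
  - rewrite -lu /l limn_einf_lim; exact: is_cvg_einfs.
  - rewrite /u limn_esup_lim; exact: is_cvg_esups.
have [/cvg_ex[a ha]|/dvgP//] := pselect (cvgn (h ^~ x)).
move: lu => /negP; case.
have : eh ^~ x @ \oo --> a%:E by apply/fine_cvgP; split; [exact: nearW|exact: ha].
by move=> /cvg_limn_einf_sup[la ua]; rewrite /l /u la ua !eqxx.
Qed.

Lemma maxr_diff (R : realDomainType) (x : R) :
  x = Num.max x 0 - Num.max (- x) 0.
Proof.
have [x0|x0] := leP x 0; first by rewrite max_l ?sub0r ?opprK// oppr_ge0.
by rewrite max_r ?subr0// oppr_le0 ltW.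
Qed.

(** * Returns and the parts of the reward *)

Section reward_parts.
Context (R : realType) d d' (S : measurableType d) (A : measurableType d').
Variable M : mdp R S A.
Local Open Scope ereal_scope.

Definition reward_pos : (S * A)%type -> \bar R := (EFin \o reward M)^\+.
Definition reward_neg : (S * A)%type -> \bar R := (EFin \o reward M)^\-.

Lemma reward_pos_ge0 z : 0 <= reward_pos z. Proof. exact: funepos_ge0. Qed.
Lemma reward_neg_ge0 z : 0 <= reward_neg z. Proof. exact: funeneg_ge0. Qed.

Lemma reward_pos_le z : reward_pos z <= `|reward M z|%:E.
Proof.
by rewrite /reward_pos funeposE /= -EFin_max lee_fin ge_max normr_ge0 ler_norm.
Qed.

Lemma reward_neg_le z : reward_neg z <= `|reward M z|%:E.
Proof.
rewrite /reward_neg funenegE /= -EFin_max lee_fin ge_max normr_ge0 andbT.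
by rewrite -normrN ler_norm.
Qed.

Lemma measurable_reward_pos : measurable_fun setT reward_pos.
Proof. by apply: measurable_funepos; exact/measurable_EFinP. Qed.

Lemma measurable_reward_neg : measurable_fun setT reward_neg.
Proof. by apply: measurable_funeneg; exact/measurable_EFinP. Qed.

End reward_parts.

Section return_value.
Context (R : realType) d d' (S : measurableType d) (A : measurableType d').
Variables (M : mdp R S A) (T : trajectory_model M) (P : probability (Omega T) R).
Local Open Scope ereal_scope.
Local Notation gamma := (disc M)%:num.
Local Notation reward_pos := (reward_pos M).
Local Notation reward_neg := (reward_neg M).

Definition discounted_sum (q : (S * A)%type -> \bar R) (w : Omega T) :=
  \sum_(0 <= t <oo) ((gamma ^+ t)%:E * q (st T t w, ac T t w)).

Lemma measurable_discounted_sum q : measurable_fun setT q ->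
  (forall z, 0 <= q z) -> measurable_fun setT (discounted_sum q).
Proof.
move=> mq q0; apply: ge0_emeasurable_sum => [t w _|t _].
- by rewrite mule_ge0// lee_fin exprn_ge0.
- apply: measurable_funeM.
  exact: (measurableT_comp mq (measurable_st_ac (st T) (ac T) t)).
Qed.

Lemma measurable_discounted_return : measurable_fun setT (discounted_return (T := T)).
Proof.
apply: measurable_limn => n; apply: measurable_sum => t.
apply: measurable_funM => //.
exact: (measurableT_comp _ (measurable_st_ac (st T) (ac T) t)).
Qed.

Hypothesis fin : return_finite P.

Let q_abs (z : (S * A)%type) : \bar R := `|reward M z|%:E.

Let mq_abs : measurable_fun setT q_abs.
Proof. by apply/measurable_EFinP; exact: measurableT_comp. Qed.

Let abs_fin : \int[P]_w discounted_sum q_abs w < +oo.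
Proof. exact: fin. Qed.

Let discounted_sum_ge0 q w : (forall z, 0 <= q z) -> 0 <= discounted_sum q w.
Proof.
by move=> q0; apply: nneseries_ge0 => t _ _; rewrite mule_ge0// lee_fin exprn_ge0.
Qed.

Let le_abs q w : (forall z, 0 <= q z) -> (forall z, q z <= q_abs z) ->
  discounted_sum q w <= discounted_sum q_abs w.
Proof.
move=> q0 qa; apply: lee_nneseries => t _; last first.
  by rewrite lee_wpmul2l// lee_fin exprn_ge0.
by move=> _; rewrite mule_ge0// lee_fin exprn_ge0.
Qed.

Lemma integrable_discounted_sum q : measurable_fun setT q ->
  (forall z, 0 <= q z) -> (forall z, q z <= `|reward M z|%:E) ->
  P.-integrable setT (discounted_sum q).
Proof.
move=> mq q0 qa; apply/integrableP; split; first exact: measurable_discounted_sum.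
apply: le_lt_trans abs_fin; apply: ge0_le_integral => //.
- by apply: measurableT_comp => //; exact: measurable_discounted_sum.
- by apply: measurable_discounted_sum => // z; rewrite lee_fin.
- by move=> w _; rewrite gee0_abs ?discounted_sum_ge0//; exact: le_abs.
Qed.

(** A finite absolute series bounds the series of both parts, so these converge in [R] and [limn] is
    the difference of their sums. *)
Let return_split w : discounted_sum q_abs w \is a fin_num ->
  discounted_return (T := T) w =
  (fine (discounted_sum reward_pos w) - fine (discounted_sum reward_neg w))%R.
Proof.
move=> wfin.
have sum_fin q : (forall z, 0 <= q z) -> (forall z, q z <= q_abs z) ->
    discounted_sum q w \is a fin_num.
  move=> q0 qa; rewrite ge0_fin_numE ?discounted_sum_ge0//.
  by apply: le_lt_trans (le_abs w q0 qa) _; rewrite ltey_eq wfin.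
have pf := sum_fin _ (reward_pos_ge0 M) (reward_pos_le M).
have nf := sum_fin _ (reward_neg_ge0 M) (reward_neg_le M).
pose a t := reward M (st T t w, ac T t w).
have cp : series (fun t => gamma ^+ t * Num.max (a t) 0)%R @ \oo -->
    fine (discounted_sum reward_pos w).
  apply: nneseries_cvg.
    by move=> t; rewrite mulr_ge0 ?exprn_ge0// le_max lexx orbT.
  rewrite fineK//; apply: eq_eseriesr => t _.
  by rewrite /reward_pos funeposE /= -EFin_max.
have cn : series (fun t => gamma ^+ t * Num.max (- a t) 0)%R @ \oo -->
    fine (discounted_sum reward_neg w).
  apply: nneseries_cvg.
    by move=> t; rewrite mulr_ge0 ?exprn_ge0// le_max lexx orbT.
  rewrite fineK//; apply: eq_eseriesr => t _.
  by rewrite /reward_neg funenegE /= -EFin_max.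
apply/cvg_lim => //.
rewrite (_ : series _ = series (fun t => gamma ^+ t * Num.max (a t) 0)%R \-
  series (fun t => gamma ^+ t * Num.max (- a t) 0)%R)%R; first exact: cvgB.
apply/funext => n; rewrite /GRing.sub_fun /series/= -sumrB.
apply: eq_bigr => t _; rewrite -mulrBr; congr (_ * _)%R.
exact: maxr_diff.
Qed.

(** The absolute series is integrable, hence finite almost surely, so [return_split] applies outside
    a null set. *)
Lemma Rintegral_discounted_return :
  (\int[P]_w discounted_return w =
   fine (\int[P]_w discounted_sum reward_pos w) -
   fine (\int[P]_w discounted_sum reward_neg w))%R.
Proof.
have ip := integrable_discounted_sum (measurable_reward_pos M)
  (reward_pos_ge0 M) (reward_pos_le M).
have i_n := integrable_discounted_sum (measurable_reward_neg M)
  (reward_neg_ge0 M) (reward_neg_le M).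
have ia := @integrable_discounted_sum q_abs mq_abs (fun=> normr_ge0 _) (fun=> lexx _).
rewrite -fineB ?integrable_fin_num// -integralB//; congr fine.
apply: ae_eq_integral => //.
- by apply/measurable_EFinP; exact: measurable_discounted_return.
- by apply: emeasurable_funB; [exact: measurable_int ip|exact: measurable_int i_n].
have := integrable_ae measurableT ia; have := integrable_ae measurableT ip.
have := integrable_ae measurableT i_n.
apply: filterS3 => w /(_ Logic.I) nf /(_ Logic.I) pf /(_ Logic.I) af _.
by rewrite /= return_split// EFinB !fineK.
Qed.

End return_value.

Section initial_law.
Context (R : realType) d d' (S : measurableType d) (A : measurableType d').
Variables (M : mdp R S A) (T : trajectory_model M) (pi : R.-pker S ~> A).
Local Open Scope ereal_scope.

(** Since the initial law does not depend on the policy, the comparison of two chains starts with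
    error zero. *)
Lemma state_law0 U : measurable U -> state_law T pi 0 U = init M U.
Proof.
move=> mU; have := @Pinit_start _ _ _ _ _ _ T pi U setT mU measurableT.
rewrite preimage_setT setIT /state_law => e; rewrite [LHS]e /rect_law.
under eq_integral do rewrite prob_kernel.
by rewrite integral_cst// mul1e.
Qed.

Lemma Rintegral_state_law0 (f : S -> R) :
  (\int[state_law T pi 0]_s f s = \int[init M]_s f s)%R.
Proof.
by congr fine; apply: eq_measure_integral => U mU _; exact: state_law0.
Qed.

Lemma integral_Pinit_state_action t (f : (S * A)%type -> \bar R) :
  (forall z, 0 <= f z) -> measurable_fun setT f ->
  \int[pair_law (st T) (ac T) (Pinit T pi) t]_z f z =
  \int[state_law T pi t]_s \int[pi s]_a f (s, a).
Proof.
move=> f0 mf; apply: (integral_state_action (@Pinit_step _ _ _ _ _ _ T pi)) => //.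
move=> D E mD mE; rewrite Pinit_start// /rect_law.
by apply: eq_measure_integral => U mU _; apply/esym/state_law0.
Qed.

End initial_law.

Section action_value.
Context (R : realType) d d' (S : measurableType d) (A : measurableType d').
Variables (M : mdp R S A) (T : trajectory_model M) (pi : R.-pker S ~> A).
Local Open Scope ereal_scope.
Local Notation gamma := (disc M)%:num.

(** The Dirac mass at [(s, a)] is read as the Dirac mass at [s] followed by the constant kernel at
    [a], a form to which [integral_pair_law] applies. *)
Lemma integral_Pfrom_start s a (f : (S * A)%type -> \bar R) :
  (forall z, 0 <= f z) -> measurable_fun setT f ->
  \int[pair_law (st T) (ac T) (Pfrom T pi s a) 0]_z f z = f (s, a).
Proof.
move=> f0 mf; pose ka : R.-pker S ~> A := kdirac (@measurable_cst _ _ S A setT a).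
rewrite (@integral_pair_law _ _ _ _ _ _ (\d_s : probability S R)%R ka)//.
  rewrite integral_dirac//; last exact: measurable_integral_pker.
  by rewrite diracT mul1e integral_dirac ?diracT ?mul1e//; exact: (measurableT_comp mf).
move=> D E mD mE; rewrite [LHS]Pfrom_start//.
rewrite integral_mkcond integral_dirac//; last first.
  apply/(measurable_restrictT _ mD)/measurable_funTS.
  exact: (measurable_kernel ka E mE).
rewrite diracT mul1e patchE /= !diracE in_setX/=.
by case: (s \in D); rewrite ?mul1e//= diracE.
Qed.

Let Up := discounted_value M pi (reward_pos M).
Let Un := discounted_value M pi (reward_neg M).

Lemma measurable_value_pos : measurable_fun setT Up.
Proof.
apply: measurable_discounted_value; first exact: measurable_reward_pos.
exact: reward_pos_ge0.
Qed.

Lemma measurable_value_neg : measurable_fun setT Un.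
Proof.
apply: measurable_discounted_value; first exact: measurable_reward_neg.
exact: reward_neg_ge0.
Qed.

Let Up0 z : 0 <= Up z.
Proof.
by apply: discounted_value_ge0; [exact: measurable_reward_pos|exact: reward_pos_ge0].
Qed.

Let Un0 z : 0 <= Un z.
Proof.
by apply: discounted_value_ge0; [exact: measurable_reward_neg|exact: reward_neg_ge0].
Qed.

Section start.
Variable P : probability (Omega T) R.
Hypotheses (step : markov_step M (st T) (ac T) pi P) (fin : return_finite P).
Let law := pair_law (st T) (ac T) P.

Let integral_sum q : measurable_fun setT q -> (forall z, 0 <= q z) ->
  \int[P]_w discounted_sum q w = \int[law 0%N]_z discounted_value M pi q z.
Proof.
by move=> mq q0; rewrite -(integral_discounted_value step)// -integral_discounted_sum.
Qed.

(** The two bounds ensure that neither [fine] in the difference returns a default value. *)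
Lemma return_value_split :
  [/\ \int[law 0%N]_z Up z < +oo, \int[law 0%N]_z Un z < +oo &
     (\int[P]_w discounted_return w =
     fine (\int[law 0%N]_z Up z) - fine (\int[law 0%N]_z Un z))%R].
Proof.
have mp := measurable_reward_pos M.
have mn := measurable_reward_neg M.
have p0 := reward_pos_ge0 M; have n0 := reward_neg_ge0 M.
rewrite -!integral_sum//; split; last exact: Rintegral_discounted_return.
- apply: (integrable_lty measurableT); apply: integrable_discounted_sum => //.
  exact: reward_pos_le.
- apply: (integrable_lty measurableT); apply: integrable_discounted_sum => //.
  exact: reward_neg_le.
Qed.

(** The expected return as a limit of partial sums, the form needed for telescoping. *)
Lemma return_cvg :
  series (fun t => gamma ^+ t * \int[law t]_z reward M z)%R @ \oo -->
  (\int[P]_w discounted_return w)%R.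
Proof.
have mp := measurable_reward_pos M.
have mn := measurable_reward_neg M.
have p0 := reward_pos_ge0 M; have n0 := reward_neg_ge0 M.
rewrite Rintegral_discounted_return//; apply: discounted_cvg => //.
- rewrite -integral_discounted_sum// fineK//.
  apply: (integrable_fin_num measurableT); apply: integrable_discounted_sum => //.
  exact: reward_pos_le.
- rewrite -integral_discounted_sum// fineK//.
  apply: (integrable_fin_num measurableT); apply: integrable_discounted_sum => //.
  exact: reward_neg_le.
Qed.

(** An infinite integral with nonzero weight would make the whole discounted sum of the integrals of
    [|reward|] infinite, against [fin]. *)
Lemma integrable_reward t : (gamma ^+ t != 0)%R ->
  (law t).-integrable setT (EFin \o reward M).
Proof.
move=> gt; have mr : measurable_fun setT (EFin \o reward M) by exact/measurable_EFinP.
apply/integrableP; split=> //.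
have ma : measurable_fun setT (fun z => `|reward M z|%:E).
  by apply/measurable_EFinP; exact: measurableT_comp.
have := fin; rewrite /return_finite => foo.
have : \sum_(0 <= t <oo) (gamma ^+ t)%:E * \int[law t]_z `|reward M z|%:E < +oo.
  by rewrite -integral_discounted_sum// => z; rewrite lee_fin.
rewrite ltNge leye_eq => /negP h; rewrite ltNge leye_eq; apply/negP => /eqP e.
apply: h; apply/eqP; apply: (@nneseries_pinfty _ _ xpredT t) => //.
  by move=> n _; rewrite mule_ge0 ?lee_fin ?exprn_ge0// integral_ge0.
by rewrite e gt0_muley// lte_fin lt_def gt exprn_ge0.
Qed.

End start.

Hypothesis Q_fin : forall s a, return_finite (Pfrom T pi s a).

(** The starting law is a Dirac mass, so finite integrals of [Up] and [Un] become finite values at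
    every pair. *)
Let Qsplit z :
  [/\ Up z \is a fin_num, Un z \is a fin_num &
    Qval T pi z.1 z.2 = (fine (Up z) - fine (Un z))%R].
Proof.
case: z => s a.
have := return_value_split (@Pfrom_step _ _ _ _ _ _ T pi s a) (Q_fin s a).
rewrite !integral_Pfrom_start//;
  [|exact: measurable_value_neg|exact: measurable_value_pos].
by move=> [pf nf QE]; split=> //; rewrite ge0_fin_numE.
Qed.

Let Up_fin z : Up z \is a fin_num. Proof. by have [] := Qsplit z. Qed.
Let Un_fin z : Un z \is a fin_num. Proof. by have [] := Qsplit z. Qed.
Let QvalE s a : Qval T pi s a = (fine (Up (s, a)) - fine (Un (s, a)))%R.
Proof. by have [] := Qsplit (s, a). Qed.

Lemma measurable_Qval : measurable_fun setT (fun z => Qval T pi z.1 z.2).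
Proof.
rewrite (_ : (fun z => _) = fun z => (fine (Up z) - fine (Un z))%R).
  apply: measurable_funB; apply: measurableT_comp => //.
    exact: measurable_value_pos.
  exact: measurable_value_neg.
by apply/funext => -[s a]; rewrite QvalE.
Qed.

Let VvalE s : Vval T pi s = (\int[pi s]_a (fine (Up (s, a)) - fine (Un (s, a))))%R.
Proof. by apply: eq_Rintegral => a _; rewrite QvalE. Qed.

Lemma J_Vval : return_finite (Pinit T pi) ->
  (J T pi = \int[state_law T pi 0]_s Vval T pi s)%R.
Proof.
move=> Jfin; have [] := return_value_split (@Pinit_step _ _ _ _ _ _ T pi) Jfin.
have mUp := measurable_value_pos; have mUn := measurable_value_neg.
rewrite !integral_Pinit_state_action// => pf nf JE.
rewrite [LHS]JE; under [RHS]eq_Rintegral do rewrite VvalE.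
by have [_ ->] := Rintegral_pker_diff mUp mUn Up0 Un0 Up_fin Un_fin pf nf.
Qed.

(* For [gamma = 0] the integral of [V] may be a junk value. *)
Lemma Bellman s a : (Qval T pi s a =
  reward M (s, a) + gamma * \int[trans M (s, a)]_s' Vval T pi s')%R.
Proof.
pose z := (s, a); rewrite QvalE.
have mUp := measurable_value_pos; have mUn := measurable_value_neg.
have Upz : Up z = reward_pos M z + gamma%:E * step_op M pi Up z.
  by apply: discounted_value_rec; [exact: measurable_reward_pos|exact: reward_pos_ge0].
have Unz : Un z = reward_neg M z + gamma%:E * step_op M pi Un z.
  by apply: discounted_value_rec; [exact: measurable_reward_neg|exact: reward_neg_ge0].
have rE : reward M z = (fine (reward_pos M z) - fine (reward_neg M z))%R.
  by rewrite /reward_pos /reward_neg funeposE funenegE /= -!EFin_max; exact: maxr_diff.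
have rp : reward_pos M z \is a fin_num by rewrite /reward_pos funeposE /= -EFin_max.
have rn : reward_neg M z \is a fin_num by rewrite /reward_neg funenegE /= -EFin_max.
have [g0|g0] := eqVneq gamma 0%R.
  have Up_r : Up z = reward_pos M z by rewrite {1}Upz g0 mul0e adde0.
  have Un_r : Un z = reward_neg M z by rewrite {1}Unz g0 mul0e adde0.
  rewrite [fine (Up _)](congr1 fine Up_r).
  rewrite [fine (Un _)](congr1 fine Un_r).
  by rewrite g0 mul0r addr0 rE.
have gp : (0 < gamma)%R by rewrite lt_def g0 /=.
(* With [gamma > 0], an infinite value of [step_op] would make the finite number [U z] infinite. *)
have Kfin (U : (S * A)%type -> \bar R) (q : \bar R) : (forall z, 0 <= U z) ->
    U z \is a fin_num -> 0 <= q -> U z = q + gamma%:E * step_op M pi U z ->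
    step_op M pi U z < +oo.
  move=> U0 Ufin q0 Uz; rewrite ltNge leye_eq; apply/negP => /eqP e.
  by move: Ufin; rewrite Uz e gt0_muley ?lte_fin// addey// -ltNye (lt_le_trans _ q0).
have Kp : step_op M pi Up z < +oo.
  by apply: Kfin Upz => //; exact: reward_pos_ge0.
have Kn : step_op M pi Un z < +oo.
  by apply: Kfin Unz => //; exact: reward_neg_ge0.
have fineE (u q k : \bar R) : q \is a fin_num -> 0 <= k -> k < +oo ->
    u = q + gamma%:E * k -> fine u = (fine q + gamma * fine k)%R.
  by case: q => // q _; case: k => // k _ _ ->.
have fUp := fineE _ _ _ rp (step_op_ge0 M pi Up0 z) Kp Upz.
have fUn := fineE _ _ _ rn (step_op_ge0 M pi Un0 z) Kn Unz.
have VE : (\int[trans M z]_s' Vval T pi s' =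
    fine (step_op M pi Up z) - fine (step_op M pi Un z))%R.
  under eq_Rintegral do rewrite VvalE.
  exact: (Rintegral_pker_diff mUp mUn Up0 Un0 Up_fin Un_fin Kp Kn).2.
by rewrite rE VE [fine (Up _)]fUp [fine (Un _)]fUn mulrBr opprD addrACA.
Qed.

End action_value.

(** * Visitation measures *)

Section bounded_Rintegral.
Context d (Y : measurableType d) (R : realType).

Lemma prob_normr_Rintegral_le (P : probability Y R) (f : Y -> R) (e : R) :
  measurable_fun setT f -> (forall y, `|f y| <= e) -> `|\int[P]_y f y| <= e.
Proof.
move=> mf fe; have intf := prob_bounded_integrable P mf fe.
apply: (le_trans (le_normr_Rintegral measurableT intf)).
rewrite -[leRHS](prob_Rintegral_cst P e); apply: le_Rintegral => //.
- exact: integrable_norm.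
- exact: (finite_measure_integrable_cst P e measurableT).
Qed.

End bounded_Rintegral.

Section arithmetic_geometric.
Variable R : realType.

Lemma arithmetico_geometric_le (g : R) (n : nat) : 0 <= g < 1 ->
  series (fun t => g ^+ t * t%:R) n <= g / (1 - g) ^+ 2.
Proof.
move=> /andP[g0 g1].
have g1p : 0 < 1 - g by lra.
rewrite ler_pdivlMr ?exprn_gt0//.
(* The closed form of the partial sum, cleared of denominators; the remainder added on the left is
   nonnegative. *)
suff : series (fun t => g ^+ t * t%:R) n * (1 - g) ^+ 2 +
    g ^+ n * (g + n%:R * (1 - g)) = g.
  have : 0 <= g ^+ n * (g + n%:R * (1 - g)).
    by rewrite mulr_ge0 ?exprn_ge0// addr_ge0// mulr_ge0// ltW.
  by move: (_ * _) (g ^+ n * _) => x y; lra.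
elim: n => [|n ih]; first by rewrite /series/= big_geq// expr0; ring.
rewrite -[RHS]ih seriesSr (exprS g n) -natr1; ring.
Qed.

End arithmetic_geometric.

Section visitation.
Context (R : realType) d d' (S : measurableType d) (A : measurableType d').
Variables (M : mdp R S A) (T : trajectory_model M) (pi : R.-pker S ~> A).
Local Open Scope ereal_scope.
Local Notation gamma := (disc M)%:num.

Lemma ge0_integral_visitation (f : S -> \bar R) : (forall s, 0 <= f s) ->
  measurable_fun setT f ->
  \int[visitation T pi]_s f s =
  \sum_(0 <= t <oo) (gamma ^+ t)%:E * \int[state_law T pi t]_s f s.
Proof.
move=> f0 mf; rewrite ge0_integral_measure_series//.
by apply: eq_eseriesr => t _; rewrite ge0_integral_mscale.
Qed.

Lemma visitation_cvg (f : S -> R) :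
  (visitation T pi).-integrable setT (EFin \o f) ->
  series (fun t => gamma ^+ t * \int[state_law T pi t]_s f s)%R @ \oo -->
  (\int[visitation T pi]_s f s)%R.
Proof.
move=> intf; have mf := measurable_int _ intf.
have pf := integrable_pos_fin_num measurableT intf.
have nf := integrable_neg_fin_num measurableT intf.
rewrite [X in _ --> X](_ : _ =
  fine (\int[visitation T pi]_s (EFin \o f)^\+ s) -
  fine (\int[visitation T pi]_s (EFin \o f)^\- s))%R.
  apply: discounted_cvg => //; rewrite -ge0_integral_visitation ?fineK//.
  - exact: measurable_funepos.
  - exact: measurable_funeneg.
by rewrite -fineB// -integralE.
Qed.

Lemma visitation_lty : visitation T pi setT < +oo.
Proof.
have := ge0_integral_visitation (fun _ : S => lee01) (measurable_cst 1).
rewrite integral_cst// mul1e => ->.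
under eq_eseriesr do rewrite integral_cst// mul1e [X in _ * X]probability_setT mule1.
have cg := @is_cvg_geometric_series R 1 gamma.
have {}cg : cvgn (series (geometric 1 gamma)).
  by apply: cg; rewrite ger0_norm ?disc_lt1.
rewrite [X in X < _](_ : _ = (limn (series (geometric 1 gamma)))%:E) ?ltry//.
rewrite -EFin_lim//; congr (limn _); apply/funext => n /=.
rewrite /series/= -sumEFin; apply: eq_bigr => t _.
by rewrite /geometric/= mul1r.
Qed.

Lemma visitation_integrable (f : S -> R) (e : R) : measurable_fun setT f ->
  (forall s, `|f s| <= e)%R -> (visitation T pi).-integrable setT (EFin \o f).
Proof. by apply: bounded_integrable; exact: visitation_lty. Qed.

End visitation.

Section visitation_difference.
Context (R : realType) d d' (S : measurableType d) (A : measurableType d').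
Variables (M : mdp R S A) (T : trajectory_model M).
Local Notation gamma := (disc M)%:num.

(** The difference is a limit of partial sums, each at most [C] times a partial sum of
    [t * gamma^t]. *)
Lemma visitation_diff_le (pi1 pi2 : R.-pker S ~> A) (f : S -> R) (e C : R) :
  measurable_fun setT f -> (forall s, `|f s| <= e) ->
  (forall t, `|\int[state_law T pi1 t]_s f s - \int[state_law T pi2 t]_s f s| <=
    t%:R * C) ->
  `|\int[visitation T pi1]_s f s - \int[visitation T pi2]_s f s| <=
  C * (gamma / (1 - gamma) ^+ 2).
Proof.
move=> mf fe diff.
have C0 : 0 <= C by have := diff 1%N; rewrite mul1r; exact: le_trans.
have c1 := visitation_cvg (visitation_integrable T pi1 mf fe).
have c2 := visitation_cvg (visitation_integrable T pi2 mf fe).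
have := cvg_norm (cvgB c1 c2) => /(_ _ _) cv.
rewrite -(cvg_lim _ cv)//; apply: limr_le; first exact: cvgP cv.
apply: nearW => n /=.
rewrite (le_trans _ (_ : C * series (fun t => gamma ^+ t * t%:R) n <= _))//; last first.
  by rewrite ler_wpM2l// arithmetico_geometric_le// disc_lt1 andbT.
change (`|series (fun t => gamma ^+ t * \int[state_law T pi1 t]_s f s) n -
  series (fun t => gamma ^+ t * \int[state_law T pi2 t]_s f s) n| <=
  C * series (fun t => gamma ^+ t * t%:R) n).
rewrite /series/= -sumrB mulr_sumr (le_trans (ler_norm_sum _ _ _))//.
apply: ler_sum => t _; rewrite -mulrBr normrM ger0_norm ?exprn_ge0//.
by rewrite mulrCA ler_wpM2l ?exprn_ge0// mulrC.
Qed.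

(** Two disintegrations: the next state through [trans], then the pair at time [t] through [pi].
    Boundedness of [f] passes to its average under [trans]. *)
Lemma state_law_rec (pi : R.-pker S ~> A) t (f : S -> R) (e : R) :
  measurable_fun setT f -> (forall s, `|f s| <= e) ->
  \int[state_law T pi t.+1]_s f s =
  \int[state_law T pi t]_s \int[pi s]_a \int[trans M (s, a)]_s' f s'.
Proof.
move=> mf fe; pose law := pair_law (st T) (ac T) (Pinit T pi) t.
have mfs : measurable_fun setT (fun z : (S * A) * S => f z.2) by exact: measurableT_comp.
have mTf : measurable_fun setT (fun z => \int[trans M z]_s' f s').
  exact: (measurable_Rintegral_pker (trans M) mfs).
have Tfe z : `|\int[trans M z]_s' f s'| <= e.
  exact: (prob_normr_Rintegral_le (pker_at (trans M) z) mf fe).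
have [_ ->] := @Rintegral_disintegration _ _ _ _ _ _ _ (trans M) law
  (state_law T pi t.+1) snd f measurable_snd
  (fun g g0 mg => integral_next_state (@Pinit_step _ _ _ _ _ _ T pi) t g0 mg)
  (prob_bounded_integrable _ mf fe).
by have [_ ->] := @Rintegral_disintegration _ _ _ _ _ _ _ pi (state_law T pi t)
  law id (fun z => \int[trans M z]_s' f s') (@measurable_id _ _ _)
  (fun g g0 mg => integral_Pinit_state_action T pi t g0 mg)
  (prob_bounded_integrable _ mTf Tfe).
Qed.

(** Induction on [t] for all [f] bounded by [e]. One step back turns [f] into [L pi1] or [L pi2].
    Exchanging these under the first chain costs [2 * e * sqrt k] by [Rintegral_diff_KL] at each
    state; the change of chain for [L pi2], again bounded by [e], is the induction hypothesis. *)
Lemma state_law_diff_le (pi1 pi2 : R.-pker S ~> A) (k e : R) : 0 <= k ->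
  (forall s, KL (pker_at pi1 s) (pker_at pi2 s) <= k%:E)%E ->
  forall t (f : S -> R), measurable_fun setT f -> (forall s, `|f s| <= e) ->
  `|\int[state_law T pi1 t]_s f s - \int[state_law T pi2 t]_s f s| <=
  t%:R * (2 * e * Num.sqrt k).
Proof.
move=> k0 KLk; elim=> [|t ih] f mf fe.
  by rewrite !Rintegral_state_law0 subrr normr0 mul0r.
have mfs : measurable_fun setT (fun z : (S * A) * S => f z.2) by exact: measurableT_comp.
pose g z := \int[trans M z]_s' f s'.
have mg : measurable_fun setT g by exact: (measurable_Rintegral_pker (trans M) mfs).
have ge z : `|g z| <= e.
  exact: (prob_normr_Rintegral_le (pker_at (trans M) z) mf fe).
have mgs s : measurable_fun setT (fun a => g (s, a)) by exact: (measurableT_comp mg).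
pose L (pi : R.-pker S ~> A) s := \int[pi s]_a g (s, a).
have mL pi : measurable_fun setT (L pi) by exact: measurable_Rintegral_pker.
have Le pi s : `|L pi s| <= e.
  exact: (prob_normr_Rintegral_le (pker_at pi s) (mgs s) (fun a => ge (s, a))).
rewrite !(state_law_rec _ _ mf fe) -/(L pi1) -/(L pi2).
have iL (mu : probability S R) pi : mu.-integrable setT (EFin \o L pi).
  exact: prob_bounded_integrable (mL pi) (Le pi).
have -> : \int[state_law T pi1 t]_s L pi1 s - \int[state_law T pi2 t]_s L pi2 s =
    \int[state_law T pi1 t]_s (L pi1 s - L pi2 s) +
    (\int[state_law T pi1 t]_s L pi2 s - \int[state_law T pi2 t]_s L pi2 s).
  by rewrite (RintegralB measurableT (iL _ _) (iL _ _)) addrA subrK.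
rewrite (le_trans (ler_normD _ _))// -natr1 mulrDl mul1r [leRHS]addrC.
rewrite lerD//; last exact: ih.
apply: prob_normr_Rintegral_le; first exact: measurable_funB.
move=> s; exact: (@Rintegral_diff_KL _ _ _ (pker_at pi1 s) (pker_at pi2 s) k e _ (mgs s)).
Qed.

End visitation_difference.

(** * The performance difference lemma *)

Section performance_difference.
Context (R : realType) d d' (S : measurableType d) (A : measurableType d').
Variables (M : mdp R S A) (T : trajectory_model M) (pi tpi : R.-pker S ~> A).
Local Notation gamma := (disc M)%:num.
Local Notation Q := (Qval T tpi).
Local Notation V := (Vval T tpi).
Hypotheses (J_pi_finite : return_finite (Pinit T pi))
  (J_tpi_finite : return_finite (Pinit T tpi))
  (Q_tpi_finite : forall s a, return_finite (Pfrom T tpi s a))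
  (Q_int_pi : forall s, (pi s).-integrable setT (EFin \o Q s))
  (V_int : (visitation T pi).-integrable setT (EFin \o V)).

Let mQ : measurable_fun setT (fun z => Q z.1 z.2).
Proof. exact: measurable_Qval. Qed.

Lemma measurable_Vval : measurable_fun setT V.
Proof. exact: (measurable_Rintegral_pker tpi mQ). Qed.

Lemma Adv_barE s : Adv_bar T pi tpi s = \int[pi s]_a Q s a - V s.
Proof.
rewrite /Adv_bar /Adv.
have iV : (pi s).-integrable setT (EFin \o cst (V s)).
  exact: (finite_measure_integrable_cst (pker_at pi s)).
rewrite (RintegralB measurableT (Q_int_pi s) iV); congr (_ - _).
exact: (prob_Rintegral_cst (pker_at pi s)).
Qed.

Lemma measurable_Adv_bar : measurable_fun setT (Adv_bar T pi tpi).
Proof.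
rewrite (_ : Adv_bar _ _ _ = fun s => \int[pi s]_a Q s a - V s).
  by apply: measurable_funB measurable_Vval; exact: (measurable_Rintegral_pker pi mQ).
by apply/funext => s; exact: Adv_barE.
Qed.

Let rho t := state_law T pi t.
Let law t := pair_law (st T) (ac T) (Pinit T pi) t.

(** The integral of [|V|] against the visitation measure is the discounted sum of its integrals
    against [rho t], so each one with nonzero weight is finite. *)
Let integrable_V t : gamma ^+ t != 0 -> (rho t).-integrable setT (EFin \o V).
Proof.
move=> gt; have mV : measurable_fun setT (EFin \o V).
  by apply/measurable_EFinP; exact: measurable_Vval.
apply/integrableP; split=> //.
have /integrableP[_] := V_int; rewrite ge0_integral_visitation//; last first.
  exact: measurableT_comp.
rewrite ltNge leye_eq => /negP h; rewrite ltNge leye_eq; apply/negP => /eqP e.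
apply: h; apply/eqP; apply: (@nneseries_pinfty _ _ xpredT t) => //.
  by move=> n _; rewrite mule_ge0 ?lee_fin ?exprn_ge0// integral_ge0.
by rewrite e gt0_muley// lte_fin lt_def gt exprn_ge0.
Qed.

Let TV z := \int[trans M z]_s V s.

(** The factor [gamma] is kept because for [gamma = 0] nothing is known about the integrability of
    [V] at time [t + 1]. *)
Let expected_V t : gamma ^+ t != 0 ->
  (law t).-integrable setT (EFin \o (fun z => gamma * TV z)) /\
  gamma * \int[law t]_z TV z = gamma * \int[rho t.+1]_s V s.
Proof.
move=> gt; have [g0|g0] := eqVneq gamma 0.
  split; last by rewrite g0 !mul0r.
  rewrite (_ : _ \o _ = cst 0%E); first exact: integrable0.
  by apply/funext => z; rewrite /= g0 mul0r.
have iV : (rho t.+1).-integrable setT (EFin \o V).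
  by apply: integrable_V; rewrite exprS mulf_neq0.
have [iTV ->] := @Rintegral_disintegration _ _ _ _ _ _ _ (trans M) (law t)
  (rho t.+1) snd V measurable_snd
  (fun g g0 mg => integral_next_state (@Pinit_step _ _ _ _ _ _ T pi) t g0 mg) iV.
by split=> //; exact: integrable_EFinZl.
Qed.

(** [Adv_bar] is the [pi]-average of [Q] minus [V]; integrating it against [rho t] and replacing [Q]
    through [Bellman] produces the values at times [t] and [t + 1]. *)
Let advantage_step t :
  gamma ^+ t * \int[rho t]_s Adv_bar T pi tpi s =
  gamma ^+ t * \int[law t]_z reward M z +
  (gamma ^+ t.+1 * \int[rho t.+1]_s V s - gamma ^+ t * \int[rho t]_s V s).
Proof.
have [gt|gt] := eqVneq (gamma ^+ t) 0.
  by rewrite exprS gt mulr0 !mul0r subrr addr0.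
have [iTV ETV] := expected_V gt; have iV := integrable_V gt.
have ir : (law t).-integrable setT (EFin \o reward M).
  exact: (integrable_reward J_pi_finite gt).
have QE : (fun z => Q z.1 z.2) = (fun z => reward M z + gamma * TV z).
  by apply/funext => -[s a]; exact: Bellman.
have iQ : (law t).-integrable setT (EFin \o (fun z => Q z.1 z.2)).
  by rewrite QE; exact: integrable_EFinD.
have [ipQ EQ] := @Rintegral_disintegration _ _ _ _ _ _ _ pi (rho t)
  (law t) id (fun z => Q z.1 z.2) (@measurable_id _ _ _)
  (fun g g0 mg => integral_Pinit_state_action T pi t g0 mg) iQ.
have -> : \int[rho t]_s Adv_bar T pi tpi s =
    \int[law t]_z Q z.1 z.2 - \int[rho t]_s V s.
  rewrite EQ -(RintegralB measurableT ipQ iV).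
  by apply: eq_Rintegral => s _; exact: Adv_barE.
have -> : \int[law t]_z Q z.1 z.2 =
    \int[law t]_z reward M z + gamma * \int[rho t.+1]_s V s.
  transitivity (\int[law t]_z (reward M z + gamma * TV z)).
    by apply: eq_Rintegral => z _; exact: (congr1 (fun f => f z) QE).
  rewrite (RintegralD measurableT ir iTV); congr (_ + _); rewrite -ETV.
  have [g0|g0] := eqVneq gamma 0.
    rewrite g0 mul0r; under eq_Rintegral do rewrite mul0r.
    by rewrite /Rintegral integral0.
  have iTV' : (law t).-integrable setT (EFin \o TV).
    have := integrable_EFinZl gamma^-1 iTV.
    by under [X in EFin \o X]eq_fun do rewrite mulrA mulVf// mul1r.
  exact: RintegralZl.
by rewrite exprSr; ring.
Qed.

(** The bound [zeta] makes [Adv_bar] integrable against the finite visitation measure, so its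
    integral is the limit of the partial sums that [advantage_step] telescopes. *)
Lemma performance_difference (zeta : R) :
  (forall s, `|Adv_bar T pi tpi s| <= zeta) ->
  \int[visitation T pi]_s Adv_bar T pi tpi s = J T pi - J T tpi.
Proof.
move=> Abound.
have iA := visitation_integrable T pi measurable_Adv_bar Abound.
have cA := visitation_cvg iA; have cV := visitation_cvg V_int.
have cr := return_cvg J_pi_finite.
(* The boundary term [gamma^n * int V d(rho n)] left by telescoping is the general term of a
   convergent series, hence tends to [0]. *)
have c0 := cvg_series_cvg_0 (cvgP _ cV).
have JV : J T tpi = \int[rho 0]_s V s.
  by rewrite J_Vval// !Rintegral_state_law0.
rewrite JV; apply: (cvg_unique _ cA) => //.
rewrite (_ : series _ = series (fun t => gamma ^+ t * \int[law t]_z reward M z) \+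
    ((fun n => gamma ^+ n * \int[rho n]_s V s) \- cst (\int[rho 0]_s V s))).
  apply: cvgD; first exact: cr.
  by rewrite -[X in _ --> X]sub0r; apply: cvgB => //; exact: cvg_cst.
apply/funext => n /=; rewrite /series/=.
under eq_bigr do rewrite advantage_step.
rewrite big_split/=; congr (_ + _).
by rewrite telescope_sumr// expr0 mul1r.
Qed.

End performance_difference.

(** * The error bound *)

Section visitation_KL.
Context (R : realType) d d' (S : measurableType d) (A : measurableType d').
Variables (M : mdp R S A) (T : trajectory_model M).
Local Notation gamma := (disc M)%:num.

(** A finite [KLmax] serves as the uniform constant [k] of [state_law_diff_le], so that
    [C = 2 * e * sqrt k] in [visitation_diff_le]. *)
Lemma visitation_diff_KLmax (pi1 pi2 : R.-pker S ~> A) (f : S -> R) (e : R) :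
  measurable_fun setT f -> (forall s, `|f s| <= e) ->
  (`|\int[visitation T pi1]_s f s - \int[visitation T pi2]_s f s|%:E <=
  (2 * gamma / (1 - gamma) ^+ 2)%:E * (e%:E * KLmax pi1 pi2 `^ 2^-1))%E.
Proof.
move=> mf fe.
have e0 : 0 <= e by exact: le_trans (fe point).
have KLle s : (KL (pker_at pi1 s) (pker_at pi2 s) <= KLmax pi1 pi2)%E.
  by apply: ereal_sup_ubound; exists s.
(* [S] contains [point], so the supremum dominates at least one nonnegative divergence. *)
have KL0 : (0 <= KLmax pi1 pi2)%E by exact: le_trans (KL_ge0 _ _) (KLle point).
have c0 : 0 <= 2 * gamma / (1 - gamma) ^+ 2.
  by rewrite divr_ge0 ?mulr_ge0 ?exprn_ge0// subr_ge0 ltW// disc_lt1.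
case: (KLmax pi1 pi2) KL0 KLle => [k| |]// KL0 KLle.
  rewrite lee_fin in KL0.
  rewrite poweR_EFin powR12_sqrt// -!EFinM lee_fin.
  have := visitation_diff_le mf fe (fun t => state_law_diff_le T KL0 KLle t mf fe).
  by move/le_trans; apply; rewrite le_eqVlt; apply/orP; left; apply/eqP; ring.
(* If [KLmax] is infinite, so is the right-hand side unless [gamma * e = 0]; in
   that case the bound [2 * e] on the total variation suffices. *)
have trivial t : `|\int[state_law T pi1 t]_s f s - \int[state_law T pi2 t]_s f s| <=
    t%:R * (2 * e).
  case: t => [|t]; first by rewrite !Rintegral_state_law0 subrr normr0 mul0r.
  rewrite (le_trans (ler_normB _ _))// (@le_trans _ _ (2 * e))//.
    by rewrite mulr_natl mulr2n lerD// prob_normr_Rintegral_le.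
  by rewrite ler_peMl ?mulr_ge0// ler1n.
have bound := visitation_diff_le mf fe trivial.
rewrite poweRyr ?invr_eq0//.
have [ce0|ce0] := eqVneq (2 * gamma / (1 - gamma) ^+ 2 * e) 0.
  rewrite (@le_trans _ _ 0%E) ?mule_ge0//.
  rewrite lee_fin (le_trans bound)// -ce0 le_eqVlt; apply/orP; left; apply/eqP; ring.
move: ce0; rewrite mulf_eq0 negb_or => /andP[cn en].
rewrite gt0_muley ?lte_fin ?lt_def ?en//.
by rewrite gt0_muley ?lte_fin ?lt_def ?cn// leey.
Qed.

End visitation_KL.

(** The final decomposition with variables for the integrals: [vp] and [vt] are those of [Adv_bar]
    for [pi] and [tpi], [wt] and [wb] those of [AdvW_bar] for [tpi] and [beta], and [j] is
    [Jtilde]. *)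
Lemma regroup_differences (R : zmodType) (jp jt vp vt wt wb j : R) :
  vp = jp - jt -> j = jt + (vt - wt) + wb ->
  jp - j = wt - wb + (vp - vt).
Proof.
move=> -> ->; rewrite !opprD !opprK !addrA.
by rewrite [RHS](ACl (3 * 4 * 5 * 1 * 2)).
Qed.

Unset Implicit Arguments.
Set Strict Implicit.

Theorem theorem1 (R : realType) (d d' : measure_display)
    (S : measurableType d) (A : measurableType d')
    (M : mdp R S A) (T : trajectory_model M)
    (pi tpi beta : R.-pker S ~> A)
    (Qw : S * A -> R) (mQw : measurable_fun setT Qw)
    (J_pi_finite : return_finite (Pinit T pi))
    (J_tpi_finite : return_finite (Pinit T tpi))
    (Q_tpi_finite : forall s a, return_finite (Pfrom T tpi s a))
    (Q_int_tpi : forall s, (tpi s).-integrable setT (EFin \o Qval T tpi s))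
    (Q_int_pi : forall s, (pi s).-integrable setT (EFin \o Qval T tpi s))
    (V_int : (visitation T pi).-integrable setT (EFin \o Vval T tpi))
    (Qw_int_tpi : forall s,
      (tpi s).-integrable setT (fun a => (Qw (s, a))%:E))
    (Qw_int_pi : forall s,
      (pi s).-integrable setT (fun a => (Qw (s, a))%:E))
    (eps zeta : R)
    (eps_max : eps%:E = ereal_sup (range (fun s =>
      `|AdvW_bar Qw pi tpi s|%:E)))
    (zeta_max : zeta%:E = ereal_sup (range (fun s =>
      `|Adv_bar T pi tpi s|%:E))) :
  (`|J T pi - Jtilde T Qw beta pi tpi|%:E <=
   (2 * (disc M)%:num / (1 - (disc M)%:num) ^+ 2)%:E *
   (eps%:E * KLmax tpi beta `^ 2^-1 + zeta%:E * KLmax pi tpi `^ 2^-1))%E.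
Proof.
have mQ := measurable_Qval Q_tpi_finite.
have zeta_ge s : `|Adv_bar T pi tpi s| <= zeta.
  by rewrite -lee_fin zeta_max; apply: ereal_sup_ubound; exists s.
have eps_ge s : `|AdvW_bar Qw pi tpi s| <= eps.
  by rewrite -lee_fin eps_max; apply: ereal_sup_ubound; exists s.
have mA := measurable_Adv_bar Q_tpi_finite Q_int_pi.
have cst_int (r : R) s : (pi s).-integrable setT (EFin \o cst r).
  exact: (finite_measure_integrable_cst (pker_at pi s)).
have AdvW_barE s : AdvW_bar Qw pi tpi s =
    \int[pi s]_a Qw (s, a) - \int[tpi s]_a Qw (s, a).
  rewrite /AdvW_bar /AdvW (RintegralB measurableT (Qw_int_pi s) (cst_int _ s)).
  by congr (_ - _); exact: (prob_Rintegral_cst (pker_at pi s)).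
have mAW : measurable_fun setT (AdvW_bar Qw pi tpi).
  rewrite (_ : AdvW_bar _ _ _ =
      fun s => \int[pi s]_a Qw (s, a) - \int[tpi s]_a Qw (s, a)).
    by apply: measurable_funB; exact: measurable_Rintegral_pker.
  by apply/funext => s; exact: AdvW_barE.
have iAdv s : (pi s).-integrable setT (EFin \o Adv T tpi s).
  exact: (integrable_EFinB (Q_int_pi s) (cst_int _ s)).
have iAdvW s : (pi s).-integrable setT (EFin \o AdvW Qw tpi s).
  exact: (integrable_EFinB (Qw_int_pi s) (cst_int _ s)).
have PD := performance_difference J_pi_finite J_tpi_finite Q_tpi_finite
  Q_int_pi V_int zeta_ge.
(* Linearity is available since [zeta] and [eps] bound the averaged advantages, which are thus
   integrable against the finite measure [visitation T tpi]. *)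
have split_tpi : \int[visitation T tpi]_s \int[pi s]_a (Adv T tpi s a - AdvW Qw tpi s a) =
    \int[visitation T tpi]_s Adv_bar T pi tpi s -
    \int[visitation T tpi]_s AdvW_bar Qw pi tpi s.
  rewrite -(RintegralB measurableT (visitation_integrable T tpi mA zeta_ge)
    (visitation_integrable T tpi mAW eps_ge)).
  by apply: eq_Rintegral => s _; rewrite (RintegralB measurableT (iAdv s) (iAdvW s)).
have -> : J T pi - Jtilde T Qw beta pi tpi =
    (\int[visitation T tpi]_s AdvW_bar Qw pi tpi s -
     \int[visitation T beta]_s AdvW_bar Qw pi tpi s) +
    (\int[visitation T pi]_s Adv_bar T pi tpi s -
     \int[visitation T tpi]_s Adv_bar T pi tpi s).
  have JE := congr1 (fun x => J T tpi + x +
    \int[visitation T beta]_s AdvW_bar Qw pi tpi s) split_tpi.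
  exact: regroup_differences PD JE.
have e0 : 0 <= eps by exact: le_trans (eps_ge point).
have z0 : 0 <= zeta by exact: le_trans (zeta_ge point).
rewrite ge0_muleDr ?mule_ge0 ?poweR_ge0//.
apply: (@le_trans _ _ (`|\int[visitation T tpi]_s AdvW_bar Qw pi tpi s -
    \int[visitation T beta]_s AdvW_bar Qw pi tpi s|%:E +
  `|\int[visitation T pi]_s Adv_bar T pi tpi s -
    \int[visitation T tpi]_s Adv_bar T pi tpi s|%:E)%E).
  by rewrite -EFinD lee_fin ler_normD.
by apply: leeD; exact: visitation_diff_KLmax.
Qed.
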